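(* Let $P$ be an orthogonal projection in a $W^\star$-non commutative probability space $(\mathscr{A},\tau)$ with $\tau(P)=\theta\in(0,1]$, let $S=2P-{\bf 1}$ and $\kappa=\tau(S)=2\theta-1$, let $Y=(Y_t)_{t\ge0}\subset\mathscr{A}$ be a free unitary Brownian motion $\star$-free from $P$, and let $\mu_t$ be the spectral distribution of the unitary $SY_tSY_t^\star$ on the unit circle $\mathbb{T}$. Then the Herglotz transform $$H(t,z)=\int_{\mathbb{T}}\frac{\xi+z}{\xi-z}\,d\mu_t(\xi)=1+2\sum_{n\ge1}\tau\big[(SY_tSY_t^\star)^n\big]z^n,\qquad |z|<1,$$ satisfies $$\partial_tH+\frac z2\,\partial_z(H^2)=2\kappa^2\frac{z(1+z)}{(1-z)^3},\qquad H(0,z)=\frac{1+z}{1-z},\qquad |z|<1.$$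
   Context: A $W^\star$-non commutative probability space $(\mathscr{A},\tau)$ is a von Neumann algebra $\mathscr{A}$ with unit ${\bf 1}$ endowed with a faithful (normal) tracial state $\tau$. A free unitary Brownian motion $Y=(Y_t)_{t\ge0}$ is a family of unitaries in $\mathscr{A}$ with $Y_0={\bf 1}$, with stationary $\star$-free multiplicative increments (i.e. for $0\le t_1<\dots<t_n$ the elements $Y_{t_1},Y_{t_2}Y_{t_1}^\star,\dots,Y_{t_n}Y_{t_{n-1}}^\star$ are $\star$-free and $Y_tY_s^\star$ has the law of $Y_{t-s}$ for $s<t$), and with moments $\tau(Y_t^k)=\tau((Y_t^\star)^k)=e^{-kt/2}\frac1k L^{(1)}_{k-1}(kt)$, $k\ge1$, where $L^{(1)}_{n}$ is the $n$-th Laguerre polynomial of parameter $1$ (in particular $\tau(Y_t)=e^{-t/2}$). The spectral distribution $\mu_t$ is the probability measure on $\mathbb{T}$ with $\int z^n\mu_t(dz)=\tau[(SY_tSY_t^\star)^n]$ for all $n\in\mathbb{Z}$. *)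

(* Defs.v *)
From HB Require Import structures.
From mathcomp Require Import all_boot all_order all_algebra sesquilinear.
From mathcomp Require Import all_classical all_reals all_analysis.
From mathcomp Require Import complex.
Set Implicit Arguments.
Unset Strict Implicit.
Unset Printing Implicit Defensive.
Import Order.TTheory GRing.Theory Num.Theory numFieldNormedType.Exports.
Local Open Scope classical_set_scope.
Local Open Scope ring_scope.

(* MathComp-Analysis attaches the topology of the norm to abstract
   numFieldTypes only; it is transported here to the concrete field R[i]. *)
Set Warnings "-redundant-canonical-projection".
HB.instance Definition _ (R : realType) :=
  PseudoPointedMetric.copy R[i] (R[i])^o.
HB.instance Definition _ (R : realType) := NormedModule.copy R[i] (R[i])^o.
Set Warnings "redundant-canonical-projection".

Record is_involution (R : realType) (A : algType R[i]) (star : A -> A) : Prop :=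
  IsInvolution {
    starK : forall a, star (star a) = a ;
    starD : forall a b, star (a + b) = star a + star b ;
    starZ : forall (c : R[i]) a, star (c *: a) = Num.conj c *: star a ;
    starM : forall a b, star (a * b) = star b * star a }.

(* A faithful unital *-representation [pi] of [A] by bounded operators on the
   Hilbert space [(V, ip)], whose range is closed in the weak operator
   topology.  Basic neighbourhoods of [T] in that topology are given by
   finitely many pairs of vectors and a positive radius [e]; [0 < e] in R[i]
   forces [e] to be real. *)
Record is_vn_representation (R : realType) (A : algType R[i]) (star : A -> A)
    (V : completeNormedModType R[i]) (ip : {dot V for Num.conj})
    (pi : A -> V -> V) : Prop := IsVNRepresentation {
  ip_norm : forall x, ip x x = `|x| ^+ 2 ;
  rep_linear : forall a, linear (pi a) ;
  rep_bounded : forall a, continuous (pi a) ;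
  repP : forall (c : R[i]) a b x, pi (c *: a + b) x = c *: pi a x + pi b x ;
  repM : forall a b x, pi (a * b) x = pi a (pi b x) ;
  rep1 : forall x, pi 1 x = x ;
  rep_star : forall a x y, ip (pi a x) y = ip x (pi (star a) y) ;
  rep_inj : forall a b, (forall x, pi a x = pi b x) -> a = b ;
  rep_wot_closed : forall T : {linear V -> V}, continuous T ->
    (forall (s : seq (V * V)) (e : R[i]), 0 < e ->
      exists a, forall p, p \in s -> `|ip (T p.1 - pi a p.1) p.2| < e) ->
    exists a, forall x, T x = pi a x }.

Definition is_von_neumann_algebra (R : realType) (A : algType R[i])
    (star : A -> A) : Prop :=
  is_involution star /\
  exists (V : completeNormedModType R[i]) (ip : {dot V for Num.conj})
         (pi : A -> V -> V), is_vn_representation star ip pi.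

Section NoncommutativeProbability.
Variables (R : realType) (A : algType R[i]) (star : A -> A) (tau : {scalar A}).

Definition selfadjoint (a : A) : Prop := star a = a.

Definition op_le (a b : A) : Prop := exists c, b - a = star c * c.

Definition directed_sa (D : set A) : Prop :=
  [/\ D !=set0, D `<=` selfadjoint &
      forall a b, D a -> D b -> exists2 c, D c & op_le a c /\ op_le b c].

Definition is_sup_sa (D : set A) (s : A) : Prop :=
  [/\ selfadjoint s, forall a, D a -> op_le a s &
      forall u, selfadjoint u -> (forall a, D a -> op_le a u) -> op_le s u].

(* tau (sup D) = sup (tau D); the inequality tau d <= tau s is automatic for
   a positive functional. *)
Definition normal_functional : Prop :=
  forall (D : set A) (s : A), directed_sa D -> is_sup_sa D s ->
  forall e : R[i], 0 < e -> exists2 d, D d & tau s - tau d < e.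

(* The order of R[i] makes [0 <= x] mean that [x] is a nonnegative real. *)
Record is_wstar_probability_space : Prop := IsWstarProbabilitySpace {
  wstar_vn : is_von_neumann_algebra star ;
  state1 : tau 1 = 1 ;
  state_ge0 : forall a, 0 <= tau (star a * a) ;
  state_faithful : forall a, tau (star a * a) = 0 -> a = 0 ;
  state_normal : normal_functional ;
  state_trace : forall a b, tau (a * b) = tau (b * a) }.

Definition is_projection (p : A) : Prop := selfadjoint p /\ p * p = p.

Definition is_unitary (u : A) : Prop := u * star u = 1 /\ star u * u = 1.

Definition star_subalgebra (B : set A) : Prop :=
  [/\ B 1,
      forall (c : R[i]) x y, B x -> B y -> B (c *: x + y),
      forall x y, B x -> B y -> B (x * y) &
      forall x, B x -> B (star x)].

Definition star_algebra_generated (X : set A) : set A :=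
  smallest star_subalgebra X.

Definition free_family (I : eqType) (B : I -> set A) : Prop :=
  forall s : seq (I * A), s != [::] ->
  (forall p, p \in s -> B p.1 p.2 /\ tau p.2 = 0) ->
  sorted (fun p q => p.1 != q.1) s ->
  tau (\prod_(p <- s) p.2) = 0.

Definition star_free (I : eqType) (X : I -> set A) : Prop :=
  free_family (fun i => star_algebra_generated (X i)).

Definition star_moment (a : A) (w : seq bool) : R[i] :=
  tau (\prod_(b <- w) (if b then star a else a)).

Definition same_star_law (a b : A) : Prop :=
  forall w : seq bool, star_moment a w = star_moment b w.

(* L_n^(alpha) for a natural parameter alpha. *)
Definition laguerre (alpha n : nat) : {poly R} :=
  \poly_(j < n.+1) ((-1) ^+ j * ('C(n + alpha, n - j))%:R / (j`!)%:R).

Definition free_brownian_moment (t : R) (k : nat) : R :=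
  expR (- (k%:R * t / 2)) * (k%:R^-1 * (laguerre 1 k.-1).[k%:R * t]).

(* Only the values of [Y] on [0, +oo[ matter.  For times t_0 < t_1 < ...,
   the family is Y_{t_0}, Y_{t_1} Y_{t_0}^*, Y_{t_2} Y_{t_1}^*, ... *)
Definition increment (Y : R -> A) (t : nat -> R) (i : nat) : A :=
  if i is j.+1 then Y (t j.+1) * star (Y (t j)) else Y (t 0).

Record is_free_unitary_brownian_motion (Y : R -> A) : Prop :=
  IsFreeUnitaryBrownianMotion {
    fubm_unitary : forall t, 0 <= t -> is_unitary (Y t) ;
    fubm0 : Y 0 = 1 ;
    fubm_free : forall (n : nat) (t : nat -> R), 0 <= t 0 ->
      (forall i, (i.+1 < n)%N -> t i < t i.+1) ->
      star_free (fun i : 'I_n => [set increment Y t i]) ;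
    fubm_stationary : forall s t, 0 <= s -> s < t ->
      same_star_law (Y t * star (Y s)) (Y (t - s)) ;
    fubm_moment : forall t k, 0 <= t -> (0 < k)%N ->
      tau (Y t ^+ k) = (free_brownian_moment t k)%:C%C ;
    fubm_moment_star : forall t k, 0 <= t -> (0 < k)%N ->
      tau (star (Y t) ^+ k) = (free_brownian_moment t k)%:C%C }.

Definition star_free_from_process (P : A) (Y : R -> A) : Prop :=
  star_free (fun b : bool => if b then [set P] else Y @` [set t | 0 <= t]).

(* The inverse of a unitary is its adjoint, whence the value for n < 0. *)
Definition unitary_power (u : A) (n : int) : A :=
  match n with Posz k => u ^+ k | Negz k => star u ^+ k.+1 end.

End NoncommutativeProbability.

Definition borelC (R : realType) := g_sigma_algebraType (@open R[i]).

Definition unit_circle (R : realType) : set (borelC R) :=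
  [set x : R[i] | `|x| = 1].
Arguments unit_circle R : clear implicits.

Definition circle_integral (R : realType) (mu : probability (borelC R) R)
    (f : R[i] -> R[i]) : R[i] :=
  (\int[mu]_(x in unit_circle R) complex.Re (f x)
   +i* \int[mu]_(x in unit_circle R) complex.Im (f x))%C.

(* A probability measure on the circle is a Borel probability on R[i]
   carried by the circle. *)
Definition is_spectral_distribution (R : realType) (A : algType R[i])
    (star : A -> A) (tau : {scalar A}) (u : A)
    (mu : probability (borelC R) R) : Prop :=
  mu (unit_circle R) = 1%E /\
  forall n : int, circle_integral mu (fun x => x ^ n)
                  = tau (unitary_power star u n).

Definition herglotz (R : realType) (mu : probability (borelC R) R)
    (z : R[i]) : R[i] :=
  circle_integral mu (fun x => (x + z) / (x - z)).

(* Derivative at [t] of a complex-valued function on [0, +oo[: two-sided for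
   0 < t, one-sided at t = 0. *)
Definition is_time_derivative (R : realType) (f : R -> R[i]) (t : R)
    (d : R[i]) : Prop :=
  (f (t + h) - f t) / h%:C%C @[h --> within [set h | 0 <= t + h] 0^'] --> d.

(* Main.v *)
Require Import Defs.
From HB Require Import structures.
From mathcomp Require Import all_boot all_order all_algebra.
From mathcomp Require Import all_classical all_reals all_analysis.
From mathcomp Require Import complex.
From mathcomp Require Import zify ring lra measurable_realfun.
Set Implicit Arguments.
Unset Strict Implicit.
Unset Printing Implicit Defensive.
Import Order.TTheory GRing.Theory Num.Theory numFieldNormedType.Exports.
Local Open Scope classical_set_scope.
Local Open Scope ring_scope.

(* Writing Y_{t+h} = W Y_t with W = Y_{t+h} Y_t^*, the unitary S Y_{t+h} S Y_{t+h}^*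
   equals S W T W^*, where T = Y_t S Y_t^* and W is free from the algebra
   generated by S and Y_t.  With w = W - tau(W), the Laguerre formula gives
   tau(W) = 1 - h/2, tau(w w^* ) = h, tau(w w) = - h up to O(h^2), and every
   moment with at least three factors w, w^* is O(h^2).  Expanding
   (S W T W^* )^n in w and evaluating the terms of degree two by freeness gives,
   for f_n(t) = tau((S Y_t S Y_t^* )^n) and uniformly in t,
   f_n(t+h) = f_n(t) + h F_n(t) + O(h^2) with
   F_n = n f_n - 2 sum_{j <= n} f_j (n - j) f_{n-j} + n^2 kappa^2.
   As f_n is then Lipschitz with constant O(n^2), the series
   H = 2 sum_n f_n z^n - 1 can be differentiated term by term. *)

(** The obstacle is that [w] is small only in trace: as tau(w^* w) is of order h, size estimates on
    [w] would leave the cubic terms larger than h^2. The bound O(h^2) comes from the law instead: up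
    to O(h^2), tau(W^k) is quadratic in the integer k, so its third finite differences vanish;
    freeness carries this to words interleaved with [S] and [T]. In the quadratic terms, two letters
    of the same kind cut the cyclic word (S T)^n into two even words and give - 2 f_j f_{n-j}. A
    mixed pair leaves two odd words, of trace kappa because S^2 = T^2 = 1. There are n mixed pairs
    inside one factor and n (n - 1) across two factors, whence n^2 kappa^2, and sum_n n^2 z^n = z (1
    + z) / (1 - z)^3. With G = sum_n f_n z^n and H = 2 G - 1, the remaining part of sum_n F_n z^n is
    z G' - 2 G z G' = - z H H' / 2, which gives the transport term. The one-step estimate only looks
    forward in time. Its uniformity in t is what yields backward quotients too, a step back from t
    being a step forward from an earlier time. *)

Local Notation is_unitary := Defs.is_unitary.

(** * Freeness *)

Inductive linear_span (K : pzRingType) (V : lmodType K) (X : set V) : set V :=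
| linear_span0 : linear_span X 0
| linear_spanS c x y : X x -> linear_span X y -> linear_span X (c *: x + y).

Section LinearSpan.
Context {K : pzRingType} {V : lmodType K}.
Implicit Types (X Z : set V) (x y : V).

Lemma linear_spanP X c x y :
  linear_span X x -> linear_span X y -> linear_span X (c *: x + y).
Proof.
move=> + Xy; elim=> [|d u v Xu _ IH]; first by rewrite scaler0 add0r.
by rewrite scalerDr scalerA -addrA; apply: linear_spanS.
Qed.

Lemma sub_linear_span X x : X x -> linear_span X x.
Proof.
move=> Xx; rewrite -[x]scale1r -[_ *: _]addr0.
exact: linear_spanS Xx (linear_span0 X).
Qed.

Lemma linear_span_ind_sub X Z :
    Z 0 -> (forall c x y, Z x -> Z y -> Z (c *: x + y)) ->
    X `<=` Z -> linear_span X `<=` Z.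
Proof. by move=> Z0 ZD XZ x; elim=> // c u v Xu _; apply: ZD; apply: XZ. Qed.

End LinearSpan.

Section Freeness.
Context {R : realType} {A : algType R[i]} (star : A -> A) (tau : {scalar A}).
Hypothesis tau1 : tau 1 = 1.

Definition centered (x : A) : A := x - tau x *: 1.

Lemma tau_centered x : tau (centered x) = 0.
Proof. by rewrite linearB linearZ /= tau1 mulr1 subrr. Qed.

Lemma centeredK x : tau x = 0 -> centered x = x.
Proof. by rewrite /centered => ->; rewrite scale0r subr0. Qed.

Lemma centered_decomp x : x = centered x + tau x *: 1.
Proof. by rewrite /centered subrK. Qed.

Lemma star_subalgebra_centered (B : set A) x :
  star_subalgebra star B -> B x -> B (centered x).
Proof.
move=> [B1 Blin _ _] Bx; rewrite /centered addrC -scaleNr.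
exact: Blin.
Qed.

Definition reduced_word (I : eqType) (B : I -> set A) (s : seq (I * A)) : Prop :=
  (forall p, p \in s -> B p.1 p.2 /\ tau p.2 = 0) /\
  sorted (fun p q => p.1 != q.1) s.

Lemma free_reduced (I : eqType) (B : I -> set A) s :
  free_family tau B -> reduced_word B s -> s != [::] ->
  tau (\prod_(p <- s) p.2) = 0.
Proof. by move=> free [sB ss] s0; apply: free. Qed.

Lemma reduced_word_cons (I : eqType) (B : I -> set A) p s :
  reduced_word B s -> B p.1 p.2 -> tau p.2 = 0 ->
  (forall q, ohead s = Some q -> p.1 != q.1) ->
  reduced_word B (p :: s).
Proof.
move=> [sB ss] Bp tp hd; split.
  by move=> q; rewrite inE => /predU1P[->//|]; exact: sB.
by case: s sB ss hd => //= q s _ -> /(_ _ erefl) ->.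
Qed.

Lemma reduced_word_behead (I : eqType) (B : I -> set A) p s :
  reduced_word B (p :: s) -> reduced_word B s.
Proof.
move=> [sB ss]; split; first by move=> q qs; apply: sB; rewrite inE qs orbT.
exact: path_sorted ss.
Qed.

Lemma reduced_word_cat (I : eqType) (B : I -> set A) s1 s2 :
  reduced_word B s1 -> reduced_word B s2 ->
  (forall q, s1 != [::] -> ohead s2 = Some q -> (last q s1).1 != q.1) ->
  reduced_word B (s1 ++ s2).
Proof.
move=> [sB1 ss1] [sB2 ss2] d; split.
  by move=> p; rewrite mem_cat => /orP[]; [exact: sB1|exact: sB2].
case: s1 {sB1} ss1 d => //= p s1 ss1 d; rewrite cat_path ss1 /=.
by case: s2 {sB2} ss2 d => //= q s2 -> d; rewrite andbT; exact: d.
Qed.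

(** * Associativity of freeness: regrouping the members of a free family *)

Section Grouping.
Context {I J : eqType} (f : I -> J) (B : I -> set A).
Hypothesis subB : forall i, star_subalgebra star (B i).
Hypothesis freeB : free_family tau B.

(** The span of these words is the algebra generated by the [B i] with [f i = j]. Reduced words are
    the spanning set because freeness evaluates exactly those; the empty word supplies the unit. *)
Definition fibre_word (j : J) : set A :=
  [set x | exists s, [/\ reduced_word B s, {in s, forall p, f p.1 = j} &
                        x = \prod_(p <- s) p.2]].

Definition fibre_span (j : J) : set A := linear_span (fibre_word j).

Lemma fibre_span1 j : fibre_span j 1.
Proof. by apply: sub_linear_span; exists [::]; split => //; rewrite big_nil. Qed.

(** The new letter is merged with the first one when their indices agree. The outcome is then split
    into its centred part, which starts a reduced word, and a scalar, which leaves the shorter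
    word. *)
Lemma fibre_spanMl i x y : B i x -> fibre_span (f i) y -> fibre_span (f i) (x * y).
Proof.
move=> Bx; move: y.
apply: (@linear_span_ind_sub _ _ _ [set y | fibre_span (f i) (x * y)]) => /=.
- by rewrite mulr0; exact: linear_span0.
- by move=> c y z; rewrite mulrDr -scalerAr; exact: linear_spanP.
have key z s : B i z -> reduced_word B s -> {in s, forall p, f p.1 = f i} ->
    (forall q, ohead s = Some q -> i != q.1) ->
    fibre_span (f i) (z * \prod_(p <- s) p.2).
  move=> Bz rs fs hs; rewrite [z]centered_decomp mulrDl -scalerAl addrC.
  apply: linear_spanP; first by rewrite mul1r; apply: sub_linear_span; exists s.
  apply: sub_linear_span; exists ((i, centered z) :: s); split.
  - apply: reduced_word_cons => //=; last exact: tau_centered.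
    exact: (star_subalgebra_centered (subB i)).
  - by move=> q; rewrite inE => /predU1P[->//|]; exact: fs.
  - by rewrite big_cons.
move=> _ [[|[k u] s] [rs fs ->]]; first exact: key.
have [eik|nik] := eqVneq i k; last by apply: key => // q [<-].
rewrite big_cons /= mulrA; apply: key.
- have [_ _ BM _] := subB i; apply: BM => //.
  by have [/(_ _ (mem_head _ _))[] /=] := rs; rewrite eik.
- exact: reduced_word_behead rs.
- by move=> p ps; apply: fs; rewrite inE ps orbT.
- by case: rs => _ /=; case: s {fs} => //= q s /andP[/= + _] _ [<-]; rewrite eik.
Qed.

Lemma sub_fibre_span i : B i `<=` fibre_span (f i).
Proof. by move=> x Bx; rewrite -[x]mulr1; apply: fibre_spanMl => //; exact: fibre_span1. Qed.

Lemma fibre_spanM j x y : fibre_span j x -> fibre_span j y -> fibre_span j (x * y).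
Proof.
move=> + My; move: x.
apply: (@linear_span_ind_sub _ _ _ [set x | fibre_span j (x * y)]) => /=.
- by rewrite mul0r; exact: linear_span0.
- by move=> c u v; rewrite mulrDl -scalerAl; exact: linear_spanP.
move=> _ [s [rs fs ->]]; elim: s rs fs => [|p s IH] rs fs.
  by rewrite big_nil /= mul1r.
rewrite big_cons /= -mulrA -(fs p (mem_head _ _)); apply: fibre_spanMl.
  by have [/(_ _ (mem_head _ _))[]] := rs.
rewrite (fs p (mem_head _ _)); apply: IH; first exact: reduced_word_behead rs.
by move=> q qs; apply: fs; rewrite inE qs orbT.
Qed.

Let nonempty_fibre_word j : set A :=
  [set x | exists s, [/\ reduced_word B s, {in s, forall p, f p.1 = j},
                        s != [::] & x = \prod_(p <- s) p.2]].

(** Nonempty reduced words are traceless by freeness, so centring removes exactly the component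
    along the empty word. *)
Let fibre_span_centered j x :
  fibre_span j x -> linear_span (nonempty_fibre_word j) (centered x).
Proof.
move: x; apply: (@linear_span_ind_sub _ _ _
  [set x | linear_span (nonempty_fibre_word j) (centered x)]) => /=.
- by rewrite centeredK ?linear0//; exact: linear_span0.
- move=> c x y lx ly; suff -> : centered (c *: x + y) = c *: centered x + centered y.
    exact: linear_spanP.
  rewrite /centered linearP /= scalerBr scalerDl -scalerA opprD !addrA.
  by congr (_ - _); rewrite addrAC.
move=> _ [[|p s] [rs fs ->]].
  by rewrite big_nil /= /centered tau1 scale1r subrr; exact: linear_span0.
rewrite /= centeredK; last exact: free_reduced freeB rs _.
by apply: sub_linear_span; exists (p :: s).
Qed.

(** Each traceless letter expands into nonempty reduced words over one fibre. Neighbouring letters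
    lie over different fibres, and indices with different images under [f] differ, so the
    concatenated words are again reduced over [B]. *)
Lemma free_fibre_span : free_family tau fibre_span.
Proof.
(* [t] is the part already expanded into letters of [B]; the induction consumes [s] from the
   left. *)
suff key s t : reduced_word fibre_span s -> reduced_word B t ->
    (forall p q, ohead s = Some p -> t != [::] -> f (last q t).1 != p.1) ->
    s != [::] \/ t != [::] ->
    tau (\prod_(p <- t) p.2 * \prod_(p <- s) p.2) = 0.
  move=> s s0 sB ss; have := key s [::]; rewrite big_nil mul1r; apply => //.
  by left.
elim: s t => [|[j x] s IH] t rs rt hd.
  by rewrite big_nil mulr1 => -[//|]; exact: free_reduced freeB rt.
move=> _; have [/(_ _ (mem_head _ _))[/= Mx tx] ss] := rs.
have := fibre_span_centered Mx; rewrite (centeredK tx).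
rewrite big_cons /= {Mx tx}.
have {}hd q : t != [::] -> f (last q t).1 != j by move=> t0; exact: (hd (j, x)).
have {ss}hs p : ohead s = Some p -> j != p.1.
  by case: s ss {IH rs} => //= q s /andP[jq _] [<-].
have {}rs := reduced_word_behead rs; move: x.
apply: (@linear_span_ind_sub _ _ _ [set x | tau (_ * (x * _)) = 0]) => /=.
- by rewrite mul0r mulr0 linear0.
- move=> c x y tx ty; rewrite mulrDl mulrDr -scalerAl -scalerAr linearP /=.
  by rewrite tx ty mulr0 addr0.
move=> _ [r [rr fr r0 ->]] /=; rewrite mulrA -big_cat.
have fl q : f (last q r).1 = j by case: r r0 fr {rr} => //= p r _; apply; rewrite mem_last.
apply: IH => //.
- apply: reduced_word_cat => // q t0 r0q; apply: contra_neq (hd q t0) => ->.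
  by apply: fr; case: r r0q {rr r0 fl} => //= ? ? [->]; rewrite mem_head.
- by move=> p q /hs + _; rewrite last_cat fl.
- by right; case: r r0 {rr fr fl} => //; case: t {rt hd}.
Qed.


End Grouping.
End Freeness.

(** * Generated star-subalgebras and refinement of free families *)

Section FreeFamilies.
Context {R : realType} {A : algType R[i]} (star : A -> A) (tau : {scalar A}).

Lemma star_algebra_generated_subalgebra (X : set A) :
  star_subalgebra star (star_algebra_generated star X).
Proof.
split=> [B [[B1 _ _ _] _]//|c x y Bx By B sB|x y Bx By B sB|x Bx B sB];
  have [[_ lin mul st] _] := sB.
- by apply: lin; [exact: Bx|exact: By].
- by apply: mul; [exact: Bx|exact: By].
- by apply: st; exact: Bx.
Qed.

Lemma sub_star_algebra_generated (X : set A) :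
  X `<=` star_algebra_generated star X.
Proof. by move=> x Xx B [_]; exact. Qed.

Lemma star_algebra_generated_min (X B : set A) :
  star_subalgebra star B -> X `<=` B -> star_algebra_generated star X `<=` B.
Proof. by move=> sB XB x; apply. Qed.

Lemma free_family_inj (I J : eqType) (g : I -> J) (B : J -> set A) :
  injective g -> free_family tau B -> free_family tau (fun i => B (g i)).
Proof.
move=> g_inj free s s0 sB ss.
have := free [seq (g p.1, p.2) | p <- s]; rewrite big_map /=; apply.
- by case: s s0 {sB ss}.
- by move=> _ /mapP[p ps ->]; exact: sB.
- rewrite sorted_map; apply: sub_sorted ss => p q /=.
  by apply: contra_neq => /g_inj.
Qed.

(** A maximal run of letters from [K] multiplies to an element of [C], traceless since [K] is free.
    Once all runs are multiplied out, the word alternates between [B] and [C] with traceless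
    letters. *)
Lemma free_nest (J : eqType) (B C : set A) (K : J -> set A) :
  star_subalgebra star C -> (forall j, K j `<=` C) ->
  free_family tau (fun b : bool => if b then B else C) ->
  free_family tau K ->
  free_family tau (fun o : option J => if o is Some j then K j else B).
Proof.
move=> [C1 _ CM _] KC freeBC freeK.
pose BC := (fun b : bool => if b then B else C).
have prodC r : reduced_word tau K r -> C (\prod_(p <- r) p.2).
  elim: r => [|p r IH] rr; first by rewrite big_nil.
  rewrite big_cons; apply: CM; last by apply: IH; exact: reduced_word_behead rr.
  by have [/(_ _ (mem_head _ _))[/KC]] := rr.
(* [r] collects the maximal initial run of letters from the subfamily [K] and
   [s'] the rest of the word with its own [K]-runs multiplied out *)
have split_run s :
    reduced_word tau (fun o : option J => if o is Some j then K j else B) s ->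
    exists (r : seq (J * A)) (s' : seq (bool * A)),
    [/\ reduced_word tau K r, reduced_word tau BC s',
        forall q, ohead s' = Some q -> q.1,
        \prod_(p <- s) p.2 = \prod_(p <- r) p.2 * \prod_(p <- s') p.2 &
        match s with
        | [::] => r = [::] /\ s' = [::]
        | (Some j, _) :: _ => exists x r0, r = (j, x) :: r0
        | (None, _) :: _ => r = [::] /\ s' <> [::]
        end].
  elim: s => [|[[j|] x] s IH] rs.
  - by exists [::], [::]; split=> //; rewrite !big_nil mulr1.
  - have [r [s' [rr rs' hs' es hr]]] := IH (reduced_word_behead rs).
    exists ((j, x) :: r), s'; split => //; last 2 first.
    + by rewrite !big_cons es mulrA.
    + by exists x, r.
    have [/(_ _ (mem_head _ _))[/= Kx tx] ss] := rs.
    apply: reduced_word_cons => // q hq /=.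
    case: s ss hr {rs es IH} => [_ [r0 _]|[[k|] y] s /=].
    + by rewrite r0 in hq.
    + by move=> /andP[jk _] [z [r0 er]]; move: hq; rewrite er => -[<-].
    + by move=> _ [r0 _]; rewrite r0 in hq.
  have [r [s' [rr rs' hs' es hr]]] := IH (reduced_word_behead rs).
  have [/(_ _ (mem_head _ _))[/= Bx tx] ss] := rs.
  case: s ss hr es {rs IH} => [_ [-> ->] es|[[k|] y] s //= _ hr es].
    exists [::], [:: (true, x)]; split => //=.
    - split=> // p; rewrite inE => /eqP -> //.
    - by move=> q [<-].
    - by rewrite big_cons !big_nil big_cons big_nil mul1r.
  exists [::], [:: (true, x), (false, \prod_(p <- r) p.2) & s']; split => //.
  - apply: reduced_word_cons => //=; last by move=> q [<-].
    apply: reduced_word_cons => //=; first exact: prodC.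
      by apply: (free_reduced freeK) => //; case: hr => z [r0 ->].
    by move=> q /hs'; case: q => -[].
  - by move=> q [<-].
  - by rewrite big_nil mul1r big_cons es !big_cons.
move=> s s0 sB ss.
have [r [s' [rr rs' hs' -> hr]]] := split_run s (conj sB ss).
have [r0|r0] := eqVneq r [::].
  rewrite r0 big_nil mul1r; apply: (free_reduced freeBC) => //.
  case: s s0 hr {sB ss} => // -[[j|] x] s _; first by move=> [z [r1]]; rewrite r0.
  by move=> [_ /eqP].
have := @free_reduced _ _ tau _ _ ((false, \prod_(p <- r) p.2) :: s') freeBC.
rewrite big_cons; apply => //; apply: reduced_word_cons => //=.
- exact: prodC.
- exact: free_reduced rr r0.
- by move=> q /hs'; case: q => -[].
Qed.

End FreeFamilies.

(** * Freeness of an increment from the projection and the past *)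

Section IncrementFreeness.
Context {R : realType} {A : algType R[i]} {star : A -> A} {tau : {scalar A}}.
Context {P : A} {Y : R -> A}.
Hypothesis tau1 : tau 1 = 1.
Hypothesis brownian : is_free_unitary_brownian_motion star tau Y.
Hypothesis freePY : star_free_from_process star tau P Y.

(** Three singly generated algebras are kept apart because freeness is given separately, between [P]
    and the process and between increments; [past] regroups the first two afterwards. *)
Let gen (t h : R) (o : option bool) : set A :=
  star_algebra_generated star
    [set match o with
         | None => P
         | Some false => Y t
         | Some true => Y (t + h) * star (Y t)
         end].

Let past (o : option bool) : bool := if o is Some b then ~~ b else true.

Definition increment_split (t h : R) : bool -> set A :=
  fibre_span tau past (gen t h).

Lemma free_increment_split t h : 0 <= t -> 0 < h ->
  free_family tau (increment_split t h).
Proof.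
move=> t0 h0; apply: (free_fibre_span tau1).
set C := star_algebra_generated star (Y @` [set t | 0 <= t]).
have CA : star_subalgebra star C by exact: star_algebra_generated_subalgebra.
have CY s : 0 <= s -> C (Y s) by move=> s0; apply: sub_star_algebra_generated; exists s.
have -> : gen t h = fun o => if o is Some b then gen t h (Some b)
    else star_algebra_generated star [set P] by apply/funext => -[].
apply: (@free_nest _ _ star _ _ _ C) => //.
- have [_ _ CM CS] := CA; case; apply: star_algebra_generated_min => // _ ->.
    by apply: CM; [apply: CY; rewrite addr_ge0// ltW|apply: CS; exact: CY].
  exact: CY.
- rewrite (_ : (fun b : bool => _) = (fun b : bool => star_algebra_generated star
    (if b then [set P] else Y @` [set t | 0 <= t]))); first exact: freePY.
  by apply/funext => -[].
(* For the two times [t < t + h] the family of increments is [Y t], at index 0, followed by the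
   increment proper, at index 1. *)
pose g (b : bool) : 'I_2 := if b then ord_max else ord0.
have g_inj : injective g by move=> [] [].
have free2 := fubm_free brownian (n := 2)
  (t := fun i => if i is 0%N then t else t + h) t0.
have /(free_family_inj g_inj) : star_free star tau (fun i : 'I_2 =>
    [set increment star Y (fun i => if i is 0%N then t else t + h) i]).
  by apply: free2 => -[|[]]//= _; rewrite ltrDl.
by congr free_family; apply/funext => -[].
Qed.

Lemma increment_splitM t h b x y : increment_split t h b x ->
  increment_split t h b y -> increment_split t h b (x * y).
Proof.
by apply: (fibre_spanM tau1 (star := star)) => // o;
  exact: star_algebra_generated_subalgebra.
Qed.

Lemma increment_split1 t h b : increment_split t h b 1.
Proof. exact: fibre_span1. Qed.

Lemma increment_split_lin t h b c x y : increment_split t h b x ->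
  increment_split t h b y -> increment_split t h b (c *: x + y).
Proof. exact: linear_spanP. Qed.

Let increment_split_gen t h o x b :
  past o = b -> gen t h o x -> increment_split t h b x.
Proof.
move=> <-; apply: (sub_fibre_span tau1 (star := star)) => o'.
exact: star_algebra_generated_subalgebra.
Qed.

Lemma increment_split_proj t h : increment_split t h true P.
Proof.
exact: (@increment_split_gen _ _ None _ _ erefl (sub_star_algebra_generated erefl)).
Qed.

Lemma increment_split_past t h :
  increment_split t h true (Y t) /\ increment_split t h true (star (Y t)).
Proof.
have g : gen t h (Some false) (Y t) by exact: sub_star_algebra_generated.
have [_ _ _ gS] := star_algebra_generated_subalgebra star [set Y t].
by split; apply: (@increment_split_gen _ _ (Some false) _ _ erefl) => //; exact: gS.
Qed.

Lemma increment_split_future t h (W := Y (t + h) * star (Y t)) :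
  increment_split t h false W /\ increment_split t h false (star W).
Proof.
have g : gen t h (Some true) W by exact: sub_star_algebra_generated.
have [_ _ _ gS] := star_algebra_generated_subalgebra star [set W].
by split; apply: (@increment_split_gen _ _ (Some true) _ _ erefl) => //; exact: gS.
Qed.

End IncrementFreeness.

(** * Orders of magnitude, uniform in a parameter *)

Section BigO.
Context {R : realType} {X : Type} (h : X -> R).
Hypothesis h01 : forall x, 0 <= h x <= 1.

(** [X] will be the set of all pairs of a time and a step [h x], so a single constant for all of [X]
    means an estimate uniform in time. *)
Definition bigo (d : nat) (g : X -> R[i]) : Prop :=
  exists2 C : R[i], 0 <= C & forall x, `|g x| <= C * (h x)%:C%C ^+ d.

Let hC0 x : 0 <= (h x)%:C%C :> R[i].
Proof. by rewrite lecR; have /andP[] := h01 x. Qed.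

Let hC1 x : (h x)%:C%C <= 1 :> R[i].
Proof. by rewrite lecR; have /andP[] := h01 x. Qed.

Lemma bigoW d e g : (d <= e)%N -> bigo e g -> bigo d g.
Proof.
move=> de [C C0 gC]; exists C => // x; apply: le_trans (gC x) _.
by apply: ler_wpM2l => //; exact: ler_wiXn2l.
Qed.

Lemma bigoM d e f g : bigo d f -> bigo e g -> bigo (d + e) (fun x => f x * g x).
Proof.
move=> [C C0 fC] [D D0 gD]; exists (C * D); first exact: mulr_ge0.
by move=> x; rewrite normrM exprD mulrACA; apply: ler_pM.
Qed.

Lemma bigoD d f g : bigo d f -> bigo d g -> bigo d (fun x => f x + g x).
Proof.
move=> [C C0 fC] [D D0 gD]; exists (C + D); first exact: addr_ge0.
by move=> x; rewrite mulrDl; apply: le_trans (ler_normD _ _) _; exact: lerD.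
Qed.

Lemma bigo0 d : bigo d (fun=> 0).
Proof. by exists 0 => // x; rewrite normr0 mul0r. Qed.

Lemma bigo_cst (c : R[i]) : bigo 0 (fun=> c).
Proof. by exists `|c| => // x; rewrite expr0 mulr1. Qed.

Lemma bigoN d g : bigo d g -> bigo d (fun x => - g x).
Proof. by move=> [C C0 gC]; exists C => // x; rewrite normrN. Qed.

Lemma bigoB d f g : bigo d f -> bigo d g -> bigo d (fun x => f x - g x).
Proof. by move=> fd gd; apply: bigoD => //; exact: bigoN. Qed.

Lemma eq_bigo d f g : bigo d f -> (forall x, g x = f x) -> bigo d g.
Proof. by move=> + /funext ->. Qed.

Lemma bigo_h : bigo 1 (fun x => (h x)%:C%C).
Proof. by exists 1 => // x; rewrite expr1 mul1r ger0_norm. Qed.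

End BigO.

Lemma sorted_splitP (T : Type) (e : rel T) (s : seq T) :
  sorted e s \/
  exists s1 x y s2, s = s1 ++ [:: x, y & s2] /\ ~~ e x y.
Proof.
elim: s => [|x [|y s] IH]; [by left|by left|].
case: IH => [IH|[s1 [u [v [s2 [-> euv]]]]]]; last first.
  by right; exists (x :: s1), u, v, s2.
have [exy|exy] := boolP (e x y); first by left; rewrite /= exy.
by right; exists [::], x, y, s.
Qed.

(** * Traces of words containing small free letters *)

Section FreeOrder.
Context {R : realType} {A : algType R[i]} {tau : {scalar A}}.
Context {X : Type} {h : X -> R} {B : X -> bool -> set A}.
Context {L : bool -> nat -> set (X -> A)}.
Hypothesis h01 : forall x, 0 <= h x <= 1.
Hypothesis tau1 : tau 1 = 1.
Hypothesis freeB : forall x, free_family tau (B x).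
Hypothesis B1 : forall x b, B x b 1.
Hypothesis Blin : forall x b c u v, B x b u -> B x b v -> B x b (c *: u + v).

(* Graded letters: [L b d] consists of elements of the algebra [b], each of
   which is thought of as having degree [d] in the small centred elements. *)
Hypothesis LB : forall b d a x, L b d a -> B x b (a x).
Hypothesis LM : forall b d e a a', L b d a -> L b e a' ->
  L b (d + e) (fun x => a x * a' x).

(* A product of [d] small centred letters has trace O(1), O(h), O(h), O(h^2)
   for d = 0, 1, 2, 3, and O(h^2) beyond *)
Definition trace_order (d : nat) : nat := minn 2 (uphalf d).

Lemma trace_order_leq d e : (d <= e)%N -> (trace_order d <= trace_order e)%N.
Proof. rewrite /trace_order; lia. Qed.

(** Freeness turns the trace of a word into products of traces of its pieces; subadditivity lets
    these pieces be estimated one by one. *)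
Lemma trace_orderD d e : (trace_order (d + e) <= trace_order d + trace_order e)%N.
Proof. rewrite /trace_order; lia. Qed.

Definition small (d : nat) (g : X -> R[i]) := bigo h (trace_order d) g.

Lemma smallM d e f g : small d f -> small e g -> small (d + e) (fun x => f x * g x).
Proof.
move=> fd ge; apply: (@bigoW _ _ _ h01 _ (trace_order d + trace_order e)).
  exact: trace_orderD.
exact: bigoM.
Qed.

Hypothesis Ltau : forall b d a, L b d a -> small d (fun x => tau (a x)).

Definition letter : Type := bool * (nat * (X -> A)).

Fixpoint letters (s : seq letter) : Prop :=
  if s is p :: s' then L p.1 p.2.1 p.2.2 /\ letters s' else True.

Definition degree (s : seq letter) : nat := \sum_(p <- s) p.2.1.

Definition word (s : seq letter) (x : X) : A := \prod_(p <- s) p.2.2 x.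

Let cword (s : seq letter) (x : X) : A := \prod_(p <- s) centered tau (p.2.2 x).

Lemma letters_cat s1 s2 : letters (s1 ++ s2) <-> letters s1 /\ letters s2.
Proof. by elim: s1 => [|p s IH] /=; [|rewrite IH]; tauto. Qed.

Lemma degree_cat s1 s2 : degree (s1 ++ s2) = (degree s1 + degree s2)%N.
Proof. by rewrite /degree big_cat. Qed.

Lemma word_cat s1 s2 x : word (s1 ++ s2) x = word s1 x * word s2 x.
Proof. by rewrite /word big_cat. Qed.

Let cword_free s x : letters s -> sorted (fun p q => p.1 != q.1) s -> size s != 0%N ->
  tau (cword s x) = 0.
Proof.
move=> Ls ss s0; rewrite /cword.
have := @freeB x [seq (p.1, centered tau (p.2.2 x)) | p <- s].
rewrite big_map /=; apply.
- by case: s s0 {Ls ss}.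
- move=> p ps; suff : B x p.1 p.2 /\ tau p.2 = 0 by [].
  elim: s Ls ps {ss s0} => //= q s IH [Lq Ls]; rewrite inE => /predU1P[->/=|]; last exact: IH.
  split; last exact: tau_centered.
  by rewrite /centered addrC -scaleNr; apply: Blin; [exact: B1|exact: (LB _ Lq)].
- by rewrite sorted_map.
Qed.

Let cword_step s1 p s2 x :
  tau (word s1 x * cword (p :: s2) x) =
  tau (word (s1 ++ [:: p]) x * cword s2 x) -
  tau (p.2.2 x) * tau (word s1 x * cword s2 x).
Proof.
rewrite /cword big_cons -/(cword s2 x) word_cat /word big_seq1.
rewrite {1}/centered mulrBl mulrBr linearB /= mulrA; congr (_ - _).
by rewrite -scalerAl mul1r -scalerAr linearZ.
Qed.

(* Centring the letters of a word one at a time costs, at each step, the trace of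
   a letter times the trace of a shorter word; the fully centred word has trace
   0 when neighbouring letters alternate, and otherwise two of them merge. *)
Lemma small_word s : letters s -> small (degree s) (fun x => tau (word s x)).
Proof.
have cword0 s1 : (fun x => tau (word s1 x * cword [::] x)) = fun x => tau (word s1 x).
  by apply/funext => x; rewrite /cword big_nil mulr1.
have degree0 : degree [::] = 0%N by rewrite /degree big_nil.
have degree1 p : degree [:: p] = p.2.1 by rewrite /degree big_seq1.
have degree_cons p s1 : degree (p :: s1) = (p.2.1 + degree s1)%N.
  by rewrite /degree big_cons.
(* Generalised to a prefix [s1] of raw letters and a suffix [s2] of centred ones, by strong
   induction on the total length. *)
move: s; suff key n s1 s2 : letters s1 -> letters s2 -> (size s1 + size s2 = n)%N ->
    small (degree s1 + degree s2) (fun x => tau (word s1 x * cword s2 x)).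
  by move=> s Ls; have := key _ s [::] Ls I erefl; rewrite cword0 degree0 addn0.
elim/ltn_ind: n s1 s2 => n IH.
have IHtau s1 p s2 : letters s1 -> letters s2 -> L p.1 p.2.1 p.2.2 ->
    (size s1 + size s2 < n)%N -> small (degree s1 + (p.2.1 + degree s2))
      (fun x => tau (p.2.2 x) * tau (word s1 x * cword s2 x)).
  move=> L1 L2 Lp sn; rewrite addnCA; apply: smallM; first exact: Ltau Lp.
  exact: IH sn _ _ _ _ erefl.
have full s : letters s -> size s = n -> small (degree s) (fun x => tau (word s x)).
  move=> Ls sn.
  have [ss|[s1 [p [q [s2 [es /negPn/eqP pq]]]]]] :=
    sorted_splitP (fun p q : letter => p.1 != q.1) s; last first.
    move: Ls; rewrite es => /letters_cat[Ls1 [Lp [Lq Ls2]]].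
    pose pq' : letter := (p.1, ((p.2.1 + q.2.1)%N, fun x => p.2.2 x * q.2.2 x)).
    have Lpq : letters (s1 ++ pq' :: s2).
      by apply/letters_cat; split=> //; split=> //; apply: (@LM p.1) => //; rewrite pq.
    have size_pq : (size (s1 ++ pq' :: s2) + size (nil : seq letter) = n.-1)%N.
      by rewrite addn0 -sn es !size_cat /= !addnS.
    have lt_n : (n.-1 < n)%N by rewrite -sn es size_cat /= !addnS.
    have := IH _ lt_n _ [::] Lpq I size_pq; rewrite cword0 degree0 addn0.
    rewrite -(_ : degree (s1 ++ [:: p, q & s2]) = degree (s1 ++ pq' :: s2)); last first.
      by rewrite !degree_cat !degree_cons /= -!addnA.
    move=> small_pq; refine (eq_bigo small_pq _) => x.
    by rewrite !word_cat /word !big_cons /= !mulrA.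
  suff split_word s1 s2 : s = s1 ++ s2 ->
      small (degree s1 + degree s2) (fun x => tau (word s1 x * cword s2 x)).
    by have := split_word s [::]; rewrite cats0 cword0 degree0 addn0; exact.
  (* For an alternating word the raw prefix grows from the empty one, where the whole word is
     centred and its trace vanishes; each letter made raw adds a product covered by [IHtau]. *)
  elim/last_ind: s1 s2 => [|s1 p IHs1] s2 es.
    have [s20|s20] := eqVneq (size s2) 0%N.
      rewrite (size0nil s20) cword0 degree0.
      refine (eq_bigo (bigo_cst h 1) _) => x.
      by rewrite /word big_nil tau1.
    rewrite es in ss Ls; refine (eq_bigo (bigo0 _ _) _) => x.
    by rewrite /word big_nil mul1r cword_free.
  rewrite -cats1; move: es; rewrite -cats1 -catA /= => es.
  have := Ls; rewrite es => /letters_cat[L1 [Lp L2]].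
  have := IHs1 _ es; rewrite degree_cat degree1 -addnA degree_cons.
  have small_n : (size s1 + size s2 < n)%N by rewrite -sn es size_cat /= addnS.
  move=> /bigoD/(_ (IHtau s1 p s2 L1 L2 Lp small_n)) small_p.
  refine (eq_bigo small_p _) => x.
  by rewrite cword_step subrK.
move=> s1 s2; elim: s2 s1 => [|p s2 IHs2] s1 Ls1 Ls2 sn.
  by rewrite cword0 degree0 addn0; apply: full => //; rewrite -sn addn0.
have [Lp L2] := Ls2.
have Ls1p : letters (s1 ++ [:: p]) by apply/letters_cat.
have sn' : (size (s1 ++ [:: p]) + size s2 = n)%N.
  by rewrite -sn size_cat /= addn1 addnS.
have := IHs2 _ Ls1p L2 sn'; rewrite degree_cat degree1 -addnA degree_cons.
have small_n : (size s1 + size s2 < n)%N by rewrite -sn /= addnS.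
move=> /bigoB/(_ (IHtau s1 p s2 Ls1 L2 Lp small_n)) small_p.
refine (eq_bigo small_p _) => x.
exact: cword_step.
Qed.

(** Testing [y] against every word on its left, and not just its own trace, makes the notion stable
    under left multiplication. The recursions for powers can then be followed factor by factor. *)
Definition order_ge (d : nat) (y : X -> A) : Prop :=
  forall s, letters s -> small (degree s + d) (fun x => tau (word s x * y x)).

Lemma order_ge_tau d y : order_ge d y -> small d (fun x => tau (y x)).
Proof.
move=> /(_ [::] I); rewrite /degree big_nil => yd; refine (eq_bigo yd _) => x.
by rewrite /word big_nil mul1r.
Qed.

Lemma order_ge1 : order_ge 0 (fun=> 1).
Proof.
move=> s Ls; rewrite addn0; refine (eq_bigo (small_word Ls) _) => x.
by rewrite mulr1.
Qed.

Lemma order_geD d y z : order_ge d y -> order_ge d z -> order_ge d (fun x => y x + z x).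
Proof.
move=> yd zd s Ls; refine (eq_bigo (bigoD (yd s Ls) (zd s Ls)) _) => x.
by rewrite mulrDr linearD.
Qed.

Lemma order_ge_letter b e a d y :
  L b e a -> order_ge d y -> order_ge (e + d) (fun x => a x * y x).
Proof.
move=> La yd s Ls; pose sa := s ++ [:: (b, (e, a)) : letter].
have Lsa : letters sa by apply/letters_cat.
have := yd _ Lsa; rewrite degree_cat {2}/degree big_seq1 /= -addnA => small_y.
refine (eq_bigo small_y _) => x.
by rewrite word_cat /word big_seq1 mulrA.
Qed.

Definition raises (e : nat) (a : X -> A) : Prop :=
  forall d y, order_ge d y -> order_ge (e + d) (fun x => a x * y x).

Lemma raises_letter b e a : L b e a -> raises e a.
Proof. by move=> La d y; exact: order_ge_letter La. Qed.

Lemma raisesD e a b : raises e a -> raises e b -> raises e (fun x => a x + b x).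
Proof.
move=> ra rb d y yd; rewrite (_ : (fun _ => _) = fun x => a x * y x + b x * y x).
  by apply: order_geD; [exact: ra|exact: rb].
by apply/funext => x; rewrite mulrDl.
Qed.

Lemma raisesM e f a b : raises e a -> raises f b -> raises (e + f) (fun x => a x * b x).
Proof.
move=> ra rb d y yd; rewrite (_ : (fun _ => _) = fun x => a x * (b x * y x)).
  by rewrite -addnA; apply: ra; exact: rb.
by apply/funext => x; rewrite mulrA.
Qed.

Lemma raisesZ e g a : bigo h 0 g -> raises e a -> raises e (fun x => g x *: a x).
Proof.
move=> g0 ra d y yd s Ls; have := bigoM g0 (ra d y yd s Ls); rewrite add0n => ga.
by refine (eq_bigo ga _) => x; rewrite -scalerAl -scalerAr linearZ.
Qed.

Lemma order_geW d e y : (d <= e)%N -> order_ge e y -> order_ge d y.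
Proof.
move=> de ye s Ls; apply: (bigoW h01) (ye s Ls).
by apply: trace_order_leq; rewrite leq_add2l.
Qed.

End FreeOrder.

(** * Expansion of powers *)

Section PowerExpansion.
Context {A : pzRingType}.
Variables x0 x1 x2 : A.

(* [x0 + x1 + x2] to the power [n] sorted by total degree, [x_i] being of
   degree [i]: degrees 1, 2 and at least 3 *)
Fixpoint power_part1 (n : nat) : A :=
  if n is m.+1 then x0 * power_part1 m + x1 * x0 ^+ m else 0.

Fixpoint power_part2 (n : nat) : A :=
  if n is m.+1 then x0 * power_part2 m + x1 * power_part1 m + x2 * x0 ^+ m else 0.

Fixpoint power_rest (n : nat) : A :=
  if n is m.+1 then (x0 + x1 + x2) * power_rest m +
    (x1 * power_part2 m + x2 * power_part1 m + x2 * power_part2 m) else 0.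

Lemma power_expansion n :
  (x0 + x1 + x2) ^+ n = x0 ^+ n + power_part1 n + power_part2 n + power_rest n.
Proof.
elim: n => [|n IH]; first by rewrite !expr0 /= !addr0.
rewrite exprS {1}IH mulrDr /= [RHS]addrCA [LHS]addrC; congr (_ + _).
rewrite !mulrDl !mulrDr -exprS !addrA.
by rewrite [LHS](ACl (1*4*7*2*5*8*3*6*9))/= [RHS](ACl (1*3*6*2*5*8*4*7*9))/=.
Qed.

Variables (K : pzRingType) (tau : A -> K).
Hypothesis tauD : {morph tau : x y / x + y >-> x + y}.
Hypothesis tau_mulC : forall a b, tau (a * b) = tau (b * a).

Let tau0 : tau 0 = 0.
Proof. by apply: (addIr (tau 0)); rewrite -tauD !add0r. Qed.

Lemma power_part1E n : power_part1 n = \sum_(k < n) x0 ^+ k * x1 * x0 ^+ (n - k.+1).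
Proof.
elim: n => [|n IH]; first by rewrite big_ord0.
rewrite big_ord_recl /= expr0 mul1r subn1 addrC IH mulr_sumr; congr (_ + _).
by apply: eq_bigr => k _; rewrite !mulrA -exprS.
Qed.

Let tau_sum (I : Type) (r : seq I) (F : I -> A) :
  tau (\sum_(i <- r) F i) = \sum_(i <- r) tau (F i).
Proof. exact: (big_morph tau tauD tau0). Qed.

(** By traciality the [n] positions of the single [x1] are equivalent. *)
Lemma tau_power_part1 n j :
  tau (x0 ^+ j * power_part1 n) = tau (x1 * x0 ^+ (n + j).-1) *+ n.
Proof.
rewrite power_part1E mulr_sumr tau_sum (eq_bigr (fun=> tau (x1 * x0 ^+ (n + j).-1))).
  by rewrite sumr_const card_ord.
move=> k _; rewrite -mulrA tau_mulC -!mulrA -!exprD tau_mulC -mulrA -exprD.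
by congr (tau (_ * _ ^+ _)); have := ltn_ord k; lia.
Qed.

(** Two letters [x1] separated by [k] letters occur at [n - k - 1] places in a word of length [n].
    The prefix [x0 ^+ j] serves the induction, which moves one more [x0] out at each step. At
    [k = n - 1] the truncated exponent is harmless, its multiplicity being 0. *)
Lemma tau_power_part2 n j :
  tau (x0 ^+ j * power_part2 n) = tau (x2 * x0 ^+ (n + j).-1) *+ n +
  \sum_(k < n) tau (x1 * x0 ^+ k * x1 * x0 ^+ (n + j - k.+2)) *+ (n - k.+1).
Proof.
elim: n j => [|n IH] j; first by rewrite mulr0 tau0 mulr0n big_ord0 addr0.
rewrite /= !mulrDr !tauD mulrA -exprSr IH addnS addSn -pred_Sn.
rewrite big_ord_recr /= subnn mulr0n addr0 mulrSr -!addrA; congr (_ + _).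
rewrite [RHS]addrC addrA; congr (_ + _); last by rewrite tau_mulC -mulrA -exprD.
rewrite tau_mulC power_part1E mulr_sumr mulr_suml tau_sum -big_split /=.
apply: eq_bigr => k _; have kn := ltn_ord k.
rewrite (_ : n.+1 - k.+1 = (n - k.+1).+1)%N ?mulrSr; last by lia.
congr (_ + _); rewrite !mulrA -!mulrA -exprD !mulrA.
by congr (tau (_ * _ ^+ _)); lia.
Qed.

End PowerExpansion.

(** * Expansions to first order in h *)

Section Jets.
Context {R : realType} {X : Type} {h : X -> R}.
Hypothesis h01 : forall x, 0 <= h x <= 1.
Local Notation bigo := (bigo h).

(** The expansion g = a + b h + O(h^2). The coefficients remain functions, since they depend on the
    time, and are bounded so that products of expansions expand again. *)
Definition jet (g a b : X -> R[i]) : Prop :=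
  [/\ bigo 0 a, bigo 0 b & bigo 2 (fun x => g x - (a x + b x * (h x)%:C%C))].

Lemma eq_jet g a b g' a' b' : jet g a b -> g' =1 g -> a' =1 a -> b' =1 b ->
  jet g' a' b'.
Proof. by move=> jg /funext -> /funext -> /funext ->. Qed.

Lemma jet_bigo0 g a b : jet g a b -> bigo 0 g.
Proof.
move=> [a0 b0 /(bigoW h01 (leq0n 2)) g2].
have := bigoM b0 (bigoW h01 (leq0n 1) (bigo_h h01)) => /(bigoD a0)/(bigoD g2) g0.
by refine (eq_bigo g0 _) => x; rewrite subrK.
Qed.

Lemma jet_bigo1 g b : jet g (fun=> 0) b -> bigo 1 g.
Proof.
move=> [_ b0 /(bigoW h01 (leqnSn 1)) g1].
have := bigoM b0 (bigo_h h01); rewrite add0n => /(bigoD g1) g0.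
by refine (eq_bigo g0 _) => x; rewrite add0r subrK.
Qed.

Lemma jet_bigo2 g : jet g (fun=> 0) (fun=> 0) <-> bigo 2 g.
Proof.
split=> [[_ _ g2]|g2]; first by refine (eq_bigo g2 _) => x; rewrite mul0r addr0 subr0.
split; [exact: bigo0|exact: bigo0|].
by refine (eq_bigo g2 _) => x; rewrite mul0r addr0 subr0.
Qed.

Lemma jet_bounded a : bigo 0 a -> jet a a (fun=> 0).
Proof.
move=> a0; split=> //; first exact: bigo0.
by refine (eq_bigo (bigo0 _ _) _) => x; rewrite mul0r addr0 subrr.
Qed.

Lemma jet_h : jet (fun x => (h x)%:C%C) (fun=> 0) (fun=> 1).
Proof.
split; [exact: bigo0|exact: bigo_cst|].
by refine (eq_bigo (bigo0 _ _) _) => x; rewrite mul1r add0r subrr.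
Qed.

Lemma jetD g a b g' a' b' : jet g a b -> jet g' a' b' ->
  jet (fun x => g x + g' x) (fun x => a x + a' x) (fun x => b x + b' x).
Proof.
move=> [a0 b0 g2] [a0' b0' g2']; split; [exact: bigoD|exact: bigoD|].
by refine (eq_bigo (bigoD g2 g2') _) => x; ring.
Qed.

Lemma jetM g a b g' a' b' : jet g a b -> jet g' a' b' ->
  jet (fun x => g x * g' x) (fun x => a x * a' x)
      (fun x => a x * b' x + a' x * b x).
Proof.
move=> jg jg'; have g0' := jet_bigo0 jg'; case: jg jg' => [a0 b0 g2] [a0' b0' g2'].
have bh d : bigo d (fun x => (h x)%:C%C ^+ d).
  by exists 1 => // x; rewrite mul1r ger0_norm// exprn_ge0// lecR; have /andP[] := h01 x.
have b1 : bigo 0 (fun x => b x * (h x)%:C%C).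
  by apply: (bigoW h01 (leq0n 1)); have := bigoM b0 (bigo_h h01).
split.
- exact: bigoM a0 a0'.
- by apply: bigoD; [exact: bigoM a0 b0'|exact: bigoM a0' b0].
(* The remainder of the product is (g - a - b h) g' + (a + b h) (g' - a' - b' h) + b b' h^2. *)
have t1 := bigoM g2 g0'; have t2 := bigoM (bigoD a0 b1) g2'.
have t3 := bigoM (bigoM b0 b0') (bh 2%N).
rewrite !add0n addn0 in t1 t2 t3.
by refine (eq_bigo (bigoD t1 (bigoD t2 t3)) _) => x; ring.
Qed.

Lemma jetZ c g a b : bigo 0 c -> jet g a b ->
  jet (fun x => c x * g x) (fun x => c x * a x) (fun x => c x * b x).
Proof.
move=> c0 jg; apply: (eq_jet (jetM (jet_bounded c0) jg)) => // x.
by rewrite mulr0 addr0.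
Qed.

Lemma jetZ0 c g b : bigo 0 c -> jet g (fun=> 0) b ->
  jet (fun x => c x * g x) (fun=> 0) (fun x => c x * b x).
Proof.
by move=> c0 jg; apply: (eq_jet (jetZ c0 jg)) => // x; rewrite mulr0.
Qed.

Lemma jetD0 g b g' b' : jet g (fun=> 0) b -> jet g' (fun=> 0) b' ->
  jet (fun x => g x + g' x) (fun=> 0) (fun x => b x + b' x).
Proof. by move=> jg jg'; apply: (eq_jet (jetD jg jg')) => // x; rewrite addr0. Qed.

Lemma jetN g a b : jet g a b ->
  jet (fun x => - g x) (fun x => - a x) (fun x => - b x).
Proof.
move=> jg; apply: (eq_jet (jetZ (bigo_cst h (-1)) jg)) => x; by rewrite mulN1r.
Qed.

Lemma jet_sum (n : nat) (g a b : nat -> X -> R[i]) :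
  (forall i, (i < n)%N -> jet (g i) (a i) (b i)) ->
  jet (fun x => \sum_(i < n) g i x) (fun x => \sum_(i < n) a i x)
      (fun x => \sum_(i < n) b i x).
Proof.
elim: n => [|n IH] jg.
  apply: (eq_jet (g := fun=> 0) (a := fun=> 0) (b := fun=> 0)) => [|x|x|x];
    rewrite ?big_ord0//; exact: jet_bounded (bigo0 _ _).
have := jetD (IH (fun i ni => jg i (leqW ni))) (jg n (ltnSn n)).
by move=> /eq_jet; apply => x; rewrite big_ord_recr.
Qed.

Lemma jetX1 g b n : jet g (fun=> 1) b ->
  jet (fun x => g x ^+ n) (fun=> 1) (fun x => n%:R * b x).
Proof.
move=> jg; elim: n => [|n IH].
  apply: (eq_jet (jet_bounded (bigo_cst h 1))) => x; rewrite ?expr0// mul0r//.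
apply: (eq_jet (jetM jg IH)) => x; rewrite ?exprS ?mulr1// !mul1r -natr1.
by ring.
Qed.

Lemma jetM1 g b g' b' : jet g (fun=> 1) b -> jet g' (fun=> 0) b' ->
  jet (fun x => g x * g' x) (fun=> 0) b'.
Proof.
move=> jg jg'; apply: (eq_jet (jetM jg jg')) => x //; first by rewrite mulr0.
by rewrite mul1r mul0r addr0.
Qed.

Lemma jetM11 g b g' b' : jet g (fun=> 1) b -> jet g' (fun=> 1) b' ->
  jet (fun x => g x * g' x) (fun=> 1) (fun x => b' x + b x).
Proof.
by move=> jg jg'; apply: (eq_jet (jetM jg jg')) => x //; rewrite ?mul1r.
Qed.

Lemma jet_expR (c : R) : 0 <= c ->
  jet (fun x => (expR (- (c * h x)))%:C%C) (fun=> 1) (fun=> - c%:C%C).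
Proof.
move=> c0; split; [exact: bigo_cst|exact: bigo_cst|].
exists (c ^+ 2)%:C%C => [|x]; first by rewrite lecR exprn_ge0.
have /andP[h0 _] := h01 x; have y0 := mulr_ge0 c0 h0.
rewrite -!raddfN /= -(rmorphM (real_complex R)) -(rmorph1 (real_complex R)).
rewrite -rmorphD -rmorphB /= -rmorphXn -rmorphM /= normc_def /= expr0n addr0 sqrtr_sqr lecR.
rewrite mulNr -exprMn; set y := c * h x in y0 *.
have l1 := expR_ge1Dx (- y); have l2 := expR_ge1Dx y.
have l3 : expR (- y) * expR y = 1 by rewrite -expRD addNr expR0.
(* Indeed exp(-y) (1 + y) <= 1 <= 1 + y^3 = (1 - y + y^2) (1 + y). *)
have l4 : expR (- y) <= 1 - y + y ^+ 2 by have := expR_gt0 (- y); nra.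
by rewrite ler_norml; apply/andP; split; nra.
Qed.

Lemma jet_horner (p : {poly R}) (c : R) :
  jet (fun x => (p.[c * h x])%:C%C) (fun=> (p`_0)%:C%C) (fun=> (p`_1 * c)%:C%C).
Proof.
elim/poly_ind: p => [|p d IH].
  apply: (eq_jet (jet_bounded (bigo_cst h 0))) => x; by rewrite ?horner0 ?coef0 ?mul0r.
have := jetD (jetM IH (jetZ (bigo_cst h c%:C%C) jet_h)) (jet_bounded (bigo_cst h d%:C%C)).
move=> /eq_jet; apply => x.
- by rewrite hornerMXaddC !(rmorphD (real_complex R)) !(rmorphM (real_complex R)) /=; ring.
- by rewrite coefD coefMX coefC /= !add0r; ring.
- rewrite coefD coefMX coefC /= addr0 (rmorphM (real_complex R)) /=; ring.
Qed.

(** The Laguerre polynomial starts with k - C(k,2) x. Evaluated at x = k h and divided by k it gives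
    1 - C(k,2) h, and the exponential contributes - k h / 2; the slopes add up to - k^2 / 2. *)
Lemma jet_free_brownian_moment (k : nat) : (0 < k)%N ->
  jet (fun x => (free_brownian_moment (h x) k)%:C%C) (fun=> 1)
      (fun=> - (k%:R ^+ 2 / 2)).
Proof.
move=> k0; have c0 : 0 <= k%:R / 2 :> R by rewrite divr_ge0.
have k0' : k%:R != 0 :> R by rewrite pnatr_eq0 -lt0n.
have := jetM (jet_expR c0) (jetZ (bigo_cst h (k%:R^-1)%:C%C) (jet_horner (laguerre R 1 k.-1) k%:R)).
have -> : (laguerre R 1 k.-1)`_0 = k%:R.
  by rewrite coef_poly /= expr0 mul1r fact0 divr1 subn0 addn1 prednK// -subn1 bin_sub// bin1.
have -> : (laguerre R 1 k.-1)`_1 = - 'C(k, 2)%:R.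
  rewrite coef_poly; case: k k0 {c0 k0'} => [//|[|k]] _ /=; first by rewrite oppr0.
  rewrite expr1 divr1 mulN1r addn1 subn1 /= -(@bin_sub k.+2 2)// subn2 //.
move=> /eq_jet; apply => x.
- by rewrite (rmorphM (real_complex R)) /= mulrAC (rmorphM (real_complex R)).
- by rewrite mul1r -(rmorphM (real_complex R)) mulVf.
have bin : 'C(k, 2)%:R = k%:R * (k%:R - 1) / 2 :> R[i].
  apply: (@mulIf _ 2) => //; rewrite divfK// mulrC -natrM -mul_bin_diag bin1.
  by rewrite natrM -subn1 natrB.
have k0C : k%:R != 0 :> R[i] by rewrite pnatr_eq0 -lt0n.
rewrite !(rmorphM (real_complex R)) !(rmorphN (real_complex R)) !(fmorphV (real_complex R)).
rewrite !(rmorph_nat (real_complex R)) bin /=; field.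
by rewrite k0C.
Qed.

End Jets.

(** * Moments of a small increment *)

Section Unitaries.
Context {R : realType} {A : algType R[i]} {star : A -> A} {tau : {scalar A}}.
Hypothesis inv : is_involution star.

Lemma star1 : star 1 = 1.
Proof. by have := starM inv 1 (star 1); rewrite mul1r !(starK inv) mul1r. Qed.

Lemma starN a : star (- a) = - star a.
Proof. by rewrite -scaleN1r (starZ inv) rmorphN1 scaleN1r. Qed.

Lemma starB a b : star (a - b) = star a - star b.
Proof. by rewrite (starD inv) starN. Qed.

Lemma is_unitaryM u v : is_unitary star u -> is_unitary star v -> is_unitary star (u * v).
Proof.
move=> [u1 u2] [v1 v2]; split; rewrite (starM inv) mulrA.
  by rewrite -[u * v * _]mulrA v1 mulr1.
by rewrite -[star v * _ * _]mulrA u2 mulr1.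
Qed.

Lemma is_unitary_star u : is_unitary star u -> is_unitary star (star u).
Proof. by move=> [u1 u2]; split; rewrite (starK inv). Qed.

Lemma is_unitary1 : is_unitary star 1.
Proof. by split; rewrite star1 mul1r. Qed.

Lemma is_unitaryX u n : is_unitary star u -> is_unitary star (u ^+ n).
Proof.
move=> uu; elim: n => [|n IH]; first exact: is_unitary1.
by rewrite exprS; exact: is_unitaryM.
Qed.

Definition adj (b : bool) (u : A) : A := if b then star u else u.

Definition adj_sign (b : bool) : int := if b then -1 else 1.

(** With integer exponents, multiplication by [u] or its adjoint is a shift, so moments become a
    function on the integers of which finite differences can be taken. *)
Lemma unitary_powerS u k b : is_unitary star u ->
  unitary_power star u k * adj b u = unitary_power star u (k + adj_sign b).
Proof.
move=> [u1 u2]; rewrite /adj /adj_sign; case: k b => n [].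
- case: n => [|n]; first by rewrite /= mul1r.
  rewrite (_ : Posz n.+1 - 1 = n)%R; last by lia.
  by rewrite /= exprSr -mulrA u1 mulr1.
- rewrite (_ : Posz n + 1 = n.+1)%R; last by lia.
  by rewrite /= exprSr.
- rewrite (_ : Negz n - 1 = Negz n.+1)%R; last by lia.
  by rewrite /= -exprSr.
- case: n => [|n]; first by rewrite /= u2.
  rewrite (_ : Negz n.+1 + 1 = Negz n)%R; last by lia.
  by rewrite /= [_ ^+ n.+2]exprSr -mulrA u2 mulr1.
Qed.

Hypothesis tau1 : tau 1 = 1.
Hypothesis tau_ge0 : forall a, 0 <= tau (star a * a).

(** Positivity at [b + 1] and at [b] makes the sum of the traces of [b] and [star b] real. Taking
    [b = a] and [b = 'i *: a] settles the imaginary and the real part. *)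
Lemma tau_star a : tau (star a) = (tau a)^*.
Proof.
have real_tau b : tau (star b) + tau b \is Num.real.
  have -> : tau (star b) + tau b = tau (star (b + 1) * (b + 1)) - tau (star b * b) - 1.
    by rewrite (starD inv) star1 mulrDr mulrDl mul1r mulr1 !linearD /= tau1; ring.
  by rewrite !rpredB ?rpred1//; apply: ger0_real; exact: tau_ge0.
have := CrealP (real_tau a); have := CrealP (real_tau ('i *: a)).
rewrite (starZ inv) !linearZ /= !rmorphD !rmorphM /= conjCK conjCi => e1 e2.
set x := tau a in e1 e2 *; set y := tau (star a) in e1 e2 *.
have i2 : 'i * 'i = -1 :> R[i] by rewrite -expr2 sqrCi.
have {}e1 : x^* - y^* = y - x.
  have : 'i * ('i * y^* + - 'i * x^*) = 'i * (- 'i * y + 'i * x) by rewrite e1.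
  by rewrite !mulrDr !mulrA !mulrN i2 opprK !mul1r !mulN1r => <-; rewrite addrC.
apply: (@mulIf _ 2); first by rewrite pnatr_eq0.
have -> : y * 2 = (y + x) + (y - x) by ring.
by rewrite -e1 -e2; ring.
Qed.

(** The variance of [u], which is 1 - |tau u|^2, is nonnegative. *)
Lemma norm_tau_unitary u : is_unitary star u -> `|tau u| <= 1.
Proof.
move=> [_ u2]; have := tau_ge0 (centered tau u).
have -> : tau (star (centered tau u) * centered tau u) = 1 - `|tau u| ^+ 2.
  rewrite /centered starB (starZ inv) star1 mulrBr !mulrBl u2 -!scalerAl -!scalerAr.
  rewrite !mul1r !mulr1 !(linearB tau) !(linearZ_LR tau) /= tau1 tau_star normCK; ring.
by rewrite subr_ge0 expr_le1.
Qed.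

End Unitaries.
Arguments adj {R A} star b u.

Section SmallIncrement.
Context {R : realType} {A : algType R[i]} {star : A -> A} {tau : {scalar A}}.
Context {X : Type} {h : X -> R} {W : X -> A}.
Hypothesis inv : is_involution star.
Hypothesis h01 : forall x, 0 <= h x <= 1.
Hypothesis tau1 : tau 1 = 1.
Hypothesis W_unitary : forall x, is_unitary star (W x).
Hypothesis tauW : forall x k, k != 0 ->
  tau (unitary_power star (W x) k) = (free_brownian_moment (h x) `|k|)%:C%C.
Local Notation jet := (@jet R X h).

Let m x := tau (W x).
Let w x := centered tau (W x).

Let mE x : m x = (free_brownian_moment (h x) 1)%:C%C.
Proof. by rewrite -(@tauW x 1). Qed.

Lemma jet_tau_increment : jet m (fun=> 1) (fun=> - (1 / 2)).
Proof.
apply: (eq_jet (jet_free_brownian_moment h01 (ltn0Sn 0))) => x //.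
by rewrite expr1n.
Qed.

Lemma star_centered_increment x : star (w x) = star (W x) - m x *: 1.
Proof.
rewrite starB// (starZ inv) star1// conj_Creal// -/(m x) mE.
by apply/complex_realP; exists (free_brownian_moment (h x) 1).
Qed.

Lemma jet_unitary_power k :
  jet (fun x => tau (unitary_power star (W x) k)) (fun=> 1)
      (fun=> - (k%:~R ^+ 2 / 2)).
Proof.
have [->|k0] := eqVneq k 0.
  apply: (eq_jet (jet_bounded (bigo_cst h 1))) => x //.
  by rewrite expr0n /= mul0r oppr0.
have k0' : (0 < `|k|)%N by rewrite absz_gt0.
apply: (eq_jet (jet_free_brownian_moment h01 k0')) => x //; first exact: tauW.
by case: k {k0 k0'} => n //; rewrite NegzE abszN rmorphN sqrrN.
Qed.

Let moment_slope (k : int) (s : seq bool) : R[i] :=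
  match s with
  | [::] => - (k%:~R ^+ 2 / 2)
  | [:: b] => - (k * adj_sign b)%:~R
  | [:: b; c] => - (adj_sign b * adj_sign c)%:~R
  | _ => 0
  end.

(* Up to O(h^2), k |-> tau (W^k) is the quadratic 1 - h k^2 / 2, and each
   centred factor amounts to taking a finite difference of it *)
Lemma jet_centered_moment k s :
  jet (fun x => tau (unitary_power star (W x) k * \prod_(b <- s) adj star b (w x)))
      (fun=> (s == [::])%:R) (fun=> moment_slope k s).
Proof.
have step x c t l : tau (unitary_power star (W x) l * \prod_(b <- c :: t) adj star b (w x)) =
    tau (unitary_power star (W x) (l + adj_sign c) * \prod_(b <- t) adj star b (w x)) -
    m x * tau (unitary_power star (W x) l * \prod_(b <- t) adj star b (w x)).
  rewrite -unitary_powerS// big_cons (_ : adj star c (w x) = adj star c (W x) - m x *: 1).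
    by rewrite mulrBl mulrBr linearB /= mulrA -scalerAl -scalerAr linearZ mul1r.
  by case: c; rewrite /adj ?star_centered_increment.
elim: s k => [|c t IH] k.
  by apply: (eq_jet (jet_unitary_power k)) => x //; rewrite big_nil mulr1.
have := jetD (IH (k + adj_sign c)) (jetN h01 (jetM h01 jet_tau_increment (IH k))).
move=> /eq_jet; apply => [x|x|x] /=.
- by rewrite step.
- by rewrite mul1r subrr.
have signE : (adj_sign c)%:~R = (if c then - 1 else 1) :> R[i].
  by case: (c); rewrite /adj_sign ?rmorphN1.
case: t {IH} => [|d t] /=.
  by rewrite intrD intrM signE; case: (c); field.
case: t => [|d' t] /=; last by case: t => [|? ?]; ring.
by rewrite !intrM intrD signE; case: (c); ring.
Qed.

End SmallIncrement.

(** * The infinitesimal evolution of the moments *)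

Section FreePair.
Context {R : realType} {A : algType R[i]} {tau : {scalar A}} {B : bool -> set A}.
Hypothesis tau1 : tau 1 = 1.
Hypothesis tau_mulC : forall a b, tau (a * b) = tau (b * a).
Hypothesis freeB : free_family tau B.
Hypothesis B1 : forall b, B b 1.
Hypothesis Blin : forall b c u v, B b u -> B b v -> B b (c *: u + v).
Hypothesis BM : forall b u v, B b u -> B b v -> B b (u * v).

Let centeredB b u : B b u -> B b (centered tau u).
Proof. by move=> Bu; rewrite /centered addrC -scaleNr; apply: (Blin _ (B1 b)). Qed.

Lemma tau_free_mul a u : B true a -> B false u -> tau u = 0 -> tau (a * u) = 0.
Proof.
move=> Ba Bu tu; rewrite [a](centered_decomp tau) mulrDl linearD /=.
rewrite -scalerAl mul1r linearZ /= tu mulr0 addr0.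
have := freeB (s := [:: (true, centered tau a); (false, u)]).
rewrite !big_cons big_nil mulr1; apply => // p.
rewrite !inE => /orP[]/eqP -> /=; split => //; [exact: centeredB|exact: tau_centered].
Qed.

(** Splitting [a] and [b] into centred and scalar parts, the only surviving contribution is that of
    the two scalars: the others reduce to an alternating centred word or to a traceless letter
    against a free element. *)
Lemma tau_free_pair a b u v : B true a -> B true b -> B false u -> B false v ->
  tau u = 0 -> tau v = 0 -> tau (a * u * b * v) = tau a * tau b * tau (u * v).
Proof.
move=> Ba Bb Bu Bv tu tv.
have auv c : B true c -> tau (c * (u * v)) = tau c * tau (u * v).
  move=> Bc; rewrite [u * v in LHS](centered_decomp tau) mulrDr linearD /=.
  rewrite (tau_free_mul Bc (centeredB (BM Bu Bv)) (tau_centered tau1 _)) add0r.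
  by rewrite -scalerAr linearZ /= mulr1 mulrC.
have uv0 : tau (u * centered tau b * v) = 0.
  rewrite -mulrA tau_mulC -mulrA [v * u](centered_decomp tau) mulrDr linearD /=.
  rewrite (tau_free_mul (centeredB Bb) (centeredB (BM Bv Bu)) (tau_centered tau1 _)) add0r.
  by rewrite -scalerAr linearZ /= mulr1 tau_centered// mulr0.
rewrite [b in LHS](centered_decomp tau) mulrDr mulrDl linearD /= addrC.
rewrite -scalerAr mulr1 -scalerAl linearZ /= -[a * u * v]mulrA auv//.
rewrite [a in tau (a * u * _ * _)](centered_decomp tau) 3!mulrDl linearD /=.
rewrite -!scalerAl mul1r linearZ /= uv0 mulr0 addr0.
have := freeB (s := [:: (true, centered tau a); (false, u); (true, centered tau b); (false, v)]).
rewrite !big_cons big_nil mulr1 /= !mulrA => ->.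
  by rewrite addr0 -[RHS]/(tau a * (tau b * tau (u * v))); ring.
- by [].
- move=> p; rewrite !inE => /or4P[]/eqP -> /=; split => //;
    by [exact: centeredB|exact: tau_centered].
- by [].
Qed.

Lemma tau_free_pair_cyclic a b c d u v :
  B true a -> B true b -> B true c -> B true d -> B false u -> B false v ->
  tau u = 0 -> tau v = 0 ->
  tau (a * u * b * (c * v * d)) = tau (d * a) * tau (b * c) * tau (u * v).
Proof.
move=> Ba Bb Bc Bd Bu Bv tu tv; rewrite -tau_free_pair//; try exact: BM.
by rewrite !mulrA tau_mulC !mulrA.
Qed.

End FreePair.

Section OneStep.
Context {R : realType} {A : algType R[i]} {star : A -> A} {tau : {scalar A}}.
Context {X : Type} {h : X -> R} {B : X -> bool -> set A} {W S T : X -> A}.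
Variable kappa : R[i].
Hypothesis inv : is_involution star.
Hypothesis h01 : forall x, 0 <= h x <= 1.
Hypothesis tau1 : tau 1 = 1.
Hypothesis tau_ge0 : forall a, 0 <= tau (star a * a).
Hypothesis tau_mulC : forall a b, tau (a * b) = tau (b * a).
Hypothesis freeB : forall x, free_family tau (B x).
Hypothesis B1 : forall x b, B x b 1.
Hypothesis Blin : forall x b c u v, B x b u -> B x b v -> B x b (c *: u + v).
Hypothesis BM : forall x b u v, B x b u -> B x b v -> B x b (u * v).
Hypothesis W_unitary : forall x, is_unitary star (W x).
Hypothesis BW : forall x, B x false (W x) /\ B x false (star (W x)).
Hypothesis tauW : forall x k, k != 0 ->
  tau (unitary_power star (W x) k) = (free_brownian_moment (h x) `|k|)%:C%C.
Hypothesis S_unitary : forall x, is_unitary star (S x).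
Hypothesis T_unitary : forall x, is_unitary star (T x).
Hypothesis BS : forall x, B x true (S x).
Hypothesis BT : forall x, B x true (T x).
Hypothesis S2 : forall x, S x * S x = 1.
Hypothesis T2 : forall x, T x * T x = 1.
Hypothesis tauS : forall x, tau (S x) = kappa.
Hypothesis tauT : forall x, tau (T x) = kappa.

Let m x := tau (W x).
Let w x := centered tau (W x).
Let V x := S x * T x.

(** Letters of the past are unitaries: their traces are bounded by 1 and they are closed under
    products, so no operator norm is involved. Letters of the future are products of [d] factors [w]
    or [star w]. *)
Let L (b : bool) (d : nat) : set (X -> A) :=
  if b then [set a | d = 0%N /\ forall x, B x true (a x) /\ is_unitary star (a x)]
  else [set a | exists2 s : seq bool, size s = d &
                  a = fun x => \prod_(c <- s) adj star c (w x)].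

Let adj_w c x : adj star c (w x) = adj star c (W x) - m x *: 1.
Proof.
by case: c => //; exact: (star_centered_increment inv tauW).
Qed.

Let Badj c x : B x false (adj star c (w x)).
Proof.
rewrite adj_w addrC -scaleNr; apply: Blin => //.
by case: c; rewrite /adj; have [] := BW x.
Qed.

Let LB b d a x : L b d a -> B x b (a x).
Proof.
case: b => /=; first by move=> [_ /(_ x)[]].
move=> [s _ ->]; elim: s => [|c s IH]; first by rewrite big_nil.
by rewrite big_cons; apply: BM.
Qed.

Let LM b d e a a' : L b d a -> L b e a' -> L b (d + e)%N (fun x => a x * a' x).
Proof.
case: b => /= [[-> aB] [-> aB']|[s <- ->] [s' <- ->]]; last first.
  by exists (s ++ s'); rewrite ?size_cat//; apply/funext => x; rewrite big_cat.
split=> // x; have [Ba ua] := aB x; have [Ba' ua'] := aB' x.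
by split; [exact: BM|exact: is_unitaryM].
Qed.

Let jet_w s := jet_centered_moment inv h01 tau1 W_unitary tauW 0 s.

Let Ltau b d a : L b d a -> small (h := h) d (fun x => tau (a x)).
Proof.
case: b => /= [[-> aB]|[s <- ->]].
  exists 1 => // x; rewrite expr0 mulr1; apply: (norm_tau_unitary inv) => //.
  by have [] := aB x.
have := jet_w s; under eq_fun do rewrite mul1r.
case: s => [|c [|c' [|c'' s]]] /=.
- by move=> J; exact (jet_bigo0 h01 J).
- by move=> J; exact (jet_bigo1 h01 J).
- by move=> J; exact (jet_bigo1 h01 J).
- by rewrite /small (_ : trace_order _ = 2%N); [move=> /jet_bigo2|rewrite /trace_order; lia].
Qed.

Let Bpow x n : B x true (V x ^+ n).
Proof. by elim: n => [|n IH]; rewrite ?expr0 ?exprS//; do !apply: BM. Qed.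

(** An odd alternating word in [S] and [T] has equal letters at both ends. Traciality brings these
    together and they cancel; iterating leaves a single [S] or [T]. *)
Let odd_moment x n :
  tau (V x ^+ n * S x) = kappa /\ tau (T x * V x ^+ n) = kappa.
Proof.
elim: n => [|n [IHS IHT]]; first by rewrite expr0 mul1r mulr1.
split; first by rewrite exprS tau_mulC !mulrA S2 mul1r.
by rewrite exprSr /V !mulrA tau_mulC !mulrA T2 mul1r.
Qed.

Let raisesL b e a : L b e a -> @raises R A tau X h L e a.
Proof. exact: raises_letter. Qed.

Let g n x := tau (V x ^+ n).

Let g_bounded n : bigo h 0 (g n).
Proof.
exists 1 => // x; rewrite expr0 mulr1; apply: (norm_tau_unitary inv) => //.
by apply: is_unitaryX => //; apply: is_unitaryM.
Qed.

Let m_bounded : bigo h 0 m.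
Proof. by have J := jet_tau_increment h01 tauW; exact (jet_bigo0 h01 J). Qed.

(** The parts of degree 0, 1 and 2 of [S W T (star W)] after substituting [W = w + m] and
    [star W = star w + m], where [m] is real by the Laguerre formula. *)
Let x0 x := m x ^+ 2 *: V x.
Let x1 x := m x *: (S x * w x * T x + S x * T x * star (w x)).
Let x2 x := S x * w x * T x * star (w x).

Let tau_w x b : tau (adj star b (w x)) = 0.
Proof.
case: b; last exact: tau_centered.
by rewrite (tau_star inv tau1 tau_ge0) tau_centered// conjC0.
Qed.

Let raisesW b : @raises R A tau X h L 1 (fun x => adj star b (w x)).
Proof.
apply: (@raisesL false); exists [:: b] => //; apply/funext => x.
by rewrite big_seq1.
Qed.

Let raisesS : @raises R A tau X h L 0 S. Proof. exact: (@raisesL true). Qed.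
Let raisesT : @raises R A tau X h L 0 T. Proof. exact: (@raisesL true). Qed.

Let raises0 : @raises R A tau X h L 0 x0.
Proof.
apply: raisesZ; first exact: bigoM m_bounded m_bounded.
exact: raisesM raisesS raisesT.
Qed.

Let raises1 : @raises R A tau X h L 1 x1.
Proof.
apply: raisesZ => //; apply: raisesD.
  exact: raisesM (raisesM raisesS (raisesW false)) raisesT.
exact: raisesM (raisesM raisesS raisesT) (raisesW true).
Qed.

Let raises2 : @raises R A tau X h L 2 x2.
Proof. exact: raisesM (raisesM (raisesM raisesS (raisesW false)) raisesT) (raisesW true). Qed.

Local Notation order_ge := (@order_ge R A tau X h L).

Let order_ge0 d : order_ge d (fun=> 0).
Proof.
by move=> s _; refine (eq_bigo (bigo0 _ _) _) => x; rewrite mulr0 linear0.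
Qed.

Let order_power n : order_ge 0 (fun x => x0 x ^+ n).
Proof.
elim: n => [|n IH]; first exact: (order_ge1 h01 tau1 freeB B1 Blin LB LM Ltau).
rewrite (_ : (fun _ => _) = fun x => x0 x * x0 x ^+ n); first exact: raises0 IH.
by apply/funext => x; rewrite exprS.
Qed.

Let order_part1 n : order_ge 1 (fun x => power_part1 (x0 x) (x1 x) n).
Proof.
elim: n => [|n IH] /=; first exact: order_ge0.
by apply: order_geD; [exact: raises0 IH|exact: raises1 (order_power n)].
Qed.

Let order_part2 n : order_ge 2 (fun x => power_part2 (x0 x) (x1 x) (x2 x) n).
Proof.
elim: n => [|n IH] /=; [exact: order_ge0|apply: order_geD; last exact: raises2 (order_power n)].
by apply: order_geD; [exact: raises0 IH|exact: raises1 (order_part1 n)].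
Qed.

Let order_rest n : order_ge 3 (fun x => power_rest (x0 x) (x1 x) (x2 x) n).
Proof.
have weaken d y : order_ge (3 + d) y -> order_ge 3 y.
  by apply: (order_geW h01); rewrite leq_addr.
elim: n => [|n IH] /=; first exact: order_ge0.
apply: order_geD.
  rewrite (_ : (fun _ => _) = fun x => x0 x * power_rest (x0 x) (x1 x) (x2 x) n +
    x1 x * power_rest (x0 x) (x1 x) (x2 x) n + x2 x * power_rest (x0 x) (x1 x) (x2 x) n).
    apply: order_geD; last exact: (weaken 2%N _ (raises2 IH)).
    by apply: order_geD; [exact: raises0 IH|exact: (weaken 1%N _ (raises1 IH))].
  by apply/funext => x; rewrite !mulrDl.
apply: order_geD; last exact: (weaken 1%N _ (raises2 (order_part2 n))).
by apply: order_geD; [exact: raises1 (order_part2 n)|exact: raises2 (order_part1 n)].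
Qed.

Let q b c x := tau (adj star b (w x) * adj star c (w x)).

Let jet_q b c : jet (h := h) (q b c) (fun=> 0) (fun=> if b == c then -1 else 1).
Proof.
apply: (eq_jet (jet_w [:: b; c])) => x //.
  by rewrite mul1r !big_cons big_nil mulr1.
by case: b c => [] []; rewrite /adj_sign/= ?(mulN1r, mulrN1, opprK, mul1r) ?rmorphN1 ?opprK.
Qed.

Let free_pair x := tau_free_pair_cyclic tau1 tau_mulC (@freeB x) (B1 x) (@Blin x) (@BM x).

(** The linear term vanishes exactly: up to traciality, a single centred letter multiplies one
    element of the past algebra. *)
Let tau_part1 x n : tau (power_part1 (x0 x) (x1 x) n) = 0.
Proof.
have tauD : {morph tau : a b / a + b >-> a + b} by move=> a b; rewrite linearD.
have := tau_power_part1 (x0 x) (x1 x) tauD tau_mulC n 0; rewrite expr0 mul1r => ->.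
rewrite /x0 /x1 exprZn -scalerAr linearZ /= -scalerAl linearZ /=.
set j := (n + 0).-1.
have Bwf := Badj false x; have Bwt := Badj true x.
have t1 : tau (S x * w x * T x * V x ^+ j) = 0.
  rewrite -[_ * T x * _]mulrA tau_mulC mulrA.
  apply: (tau_free_mul tau1 (@freeB x) (B1 x) (@Blin x)) => //.
    by do 2!apply: BM => //.
  exact: (tau_w x false).
have t2 : tau (S x * T x * star (w x) * V x ^+ j) = 0.
  rewrite tau_mulC mulrA.
  apply: (tau_free_mul tau1 (@freeB x) (B1 x) (@Blin x)) => //.
    by apply: BM => //; exact: BM.
  exact: (tau_w x true).
by rewrite mulrDl linearD /= t1 t2 addr0 !mulr0 mul0rn.
Qed.

Let tau_x2 x j : tau (x2 x * x0 x ^+ j) = (m x ^+ 2) ^+ j * (kappa ^+ 2 * q false true x).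
Proof.
rewrite /x0 exprZn -scalerAr linearZ /=; congr (_ * _).
have := @free_pair x (S x) (T x) 1 (V x ^+ j) (w x) (star (w x))
  (BS x) (BT x) (B1 x true) (Bpow x j) (Badj false x) (Badj true x)
  (tau_w x false) (tau_w x true).
rewrite mul1r mulr1 /x2 !mulrA => ->.
by have [-> _] := odd_moment x j; rewrite tauT -expr2.
Qed.

(** Each [x1] contributes [S w T] or [S T (star w)]. Equal choices enclose two even words, with
    traces [g k.+1] and [g l.+1]; different choices enclose two odd words, both of trace [kappa]. *)
Let tau_x1 x k l :
  tau (x1 x * x0 x ^+ k * x1 x * x0 x ^+ l) =
  (m x * (m x ^+ 2) ^+ k * m x * (m x ^+ 2) ^+ l) *
  (g k.+1 x * g l.+1 x * (q false false x + q true true x) +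
   kappa ^+ 2 * (q false true x + q true false x)).
Proof.
have gE j : tau (T x * V x ^+ j * S x) = g j.+1 x.
  by rewrite tau_mulC mulrA -[S x * T x]/(V x) -exprS.
have gE' j : tau (V x ^+ j * S x * T x) = g j.+1 x.
  by rewrite -mulrA -[S x * T x]/(V x) -exprSr.
have oE j : tau (T x * V x ^+ j * S x * T x) = kappa.
  by rewrite tau_mulC !mulrA T2 mul1r; case: (odd_moment x j).
have BST : B x true (S x * T x) by exact: BM.
have Bw := Badj false x; have Bw' := Badj true x.
have tw := tau_w x false; have tw' := tau_w x true.
have e11 := @free_pair x (S x) (T x) (V x ^+ k * S x) (T x * V x ^+ l) (w x) (w x)
  (BS x) (BT x) (BM (Bpow x k) (BS x)) (BM (BT x) (Bpow x l)) Bw Bw tw tw.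
have e12 := @free_pair x (S x) (T x) (V x ^+ k * (S x * T x)) (V x ^+ l) (w x) (star (w x))
  (BS x) (BT x) (BM (Bpow x k) BST) (Bpow x l) Bw Bw' tw tw'.
have e21 := @free_pair x (S x * T x) 1 (V x ^+ k * S x) (T x * V x ^+ l) (star (w x)) (w x)
  BST (B1 x true) (BM (Bpow x k) (BS x)) (BM (BT x) (Bpow x l)) Bw' Bw tw' tw.
have e22 := @free_pair x (S x * T x) 1 (V x ^+ k * (S x * T x)) (V x ^+ l) (star (w x)) (star (w x))
  BST (B1 x true) (BM (Bpow x k) BST) (Bpow x l) Bw' Bw' tw' tw'.
rewrite mul1r mulr1 in e21 e22.
pose y := S x * w x * T x + S x * T x * star (w x).
have scale4 (a b c d e : R[i]) (u1 u2 u3 u4 : A) : e = a * b * c * d ->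
    a *: u1 * (b *: u2) * (c *: u3) * (d *: u4) = e *: (u1 * u2 * u3 * u4).
  by move=> ee; rewrite -!(scalerAl, scalerAr) !scalerA ee; congr (_ *: _); ring.
rewrite /x0 /x1 -/y !exprZn (scale4 _ _ _ _ _ _ _ _ _ erefl).
rewrite linearZ /=; congr (_ * _).
have expand (p1 p2 v1 v2 : A) : tau ((p1 + p2) * v1 * (p1 + p2) * v2) =
    tau (p1 * v1 * p1 * v2) + tau (p1 * v1 * p2 * v2) +
    (tau (p2 * v1 * p1 * v2) + tau (p2 * v1 * p2 * v2)).
  by rewrite !(mulrDl, mulrDr) !(linearD tau) /=; ring.
rewrite /y expand; rewrite !mulrA in e11 e12 e21 e22 *.
rewrite e11 e12 e21 e22 mul1r.
rewrite !gE !gE' !oE.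
have [-> _] := odd_moment x k; have [-> _] := odd_moment x l.
by rewrite /q /adj; ring.
Qed.

(** The term in - n comes from m^(2n), as m^2 = 1 - h + O(h^2). The other powers of [m] multiply
    quantities that are already O(h) and count as 1. In the last summand the factor [n - k.+1] is 0,
    so the truncated index does not matter. *)
Lemma jet_one_step n :
  jet (h := h) (fun x => tau ((S x * W x * T x * star (W x)) ^+ n)) (g n)
    (fun x => - n%:R * g n x + n%:R * kappa ^+ 2 +
      \sum_(k < n) (n - k.+1)%:R *
        (2 * kappa ^+ 2 - 2 * (g k.+1 x * g (n - k.+2).+1 x))).
Proof.
have jm : jet (h := h) m (fun=> 1) (fun=> - (1 / 2)) := jet_tau_increment h01 tauW.
have jm2 j : jet (h := h) (fun x => (m x ^+ 2) ^+ j) (fun=> 1) (fun=> - j%:R).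
  apply: (eq_jet (jetX1 h01 j (jetX1 h01 2 jm))) => x //.
  by rewrite mulrN mul1r divff ?mulrN1// pnatr_eq0.
have tauD : {morph tau : a b / a + b >-> a + b} by move=> a b; rewrite linearD.
have small_rest : jet (h := h) (fun x => tau (power_rest (x0 x) (x1 x) (x2 x) n))
    (fun=> 0) (fun=> 0).
  by apply/jet_bigo2; exact: order_ge_tau (order_rest n).
have jpart2 : jet (h := h) (fun x => tau (power_part2 (x0 x) (x1 x) (x2 x) n)) (fun=> 0)
    (fun x => n%:R * kappa ^+ 2 + \sum_(k < n) (n - k.+1)%:R *
        (2 * kappa ^+ 2 - 2 * (g k.+1 x * g (n - k.+2).+1 x))).
  have jx2 : jet (h := h) (fun x => n%:R * tau (x2 x * x0 x ^+ n.-1)) (fun=> 0)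
      (fun=> n%:R * kappa ^+ 2).
    apply: (eq_jet (jetZ0 h01 (bigo_cst h n%:R) (jetM1 h01 (jm2 n.-1)
      (jetZ0 h01 (bigo_cst h (kappa ^+ 2)) (jet_q false true))))) => x //.
      by rewrite tau_x2.
    by rewrite mulr1.
  have jx1 k : (k < n)%N -> jet (h := h)
      (fun x => (n - k.+1)%:R * tau (x1 x * x0 x ^+ k * x1 x * x0 x ^+ (n - k.+2)))
      (fun=> 0) (fun x => (n - k.+1)%:R *
        (2 * kappa ^+ 2 - 2 * (g k.+1 x * g (n - k.+2).+1 x))).
    move=> kn; have jmm := jetM11 h01 (jetM11 h01 (jetM11 h01 jm (jm2 k)) jm) (jm2 (n - k.+2)%N).
    have gg : bigo h 0 (fun x => g k.+1 x * g (n - k.+2).+1 x).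
      exact: (bigoM (g_bounded k.+1) (g_bounded (n - k.+2).+1)).
    have jqq := jetD0
      (jetZ0 h01 gg (jetD0 (jet_q false false) (jet_q true true)))
      (jetZ0 h01 (bigo_cst h (kappa ^+ 2)) (jetD0 (jet_q false true) (jet_q true false))).
    apply: (eq_jet (jetZ0 h01 (bigo_cst h (n - k.+1)%:R)
      (jetM1 h01 jmm jqq))) => x //.
      by rewrite tau_x1.
    by rewrite /=; congr (_ * _); ring.
  have jsum := eq_jet (jet_sum jx1) (frefl _) (fun x => esym (big1_eq _ _)) (frefl _).
  apply: (eq_jet (jetD0 jx2 jsum)) => // x.
  have := tau_power_part2 (x0 x) (x1 x) (x2 x) tauD tau_mulC n 0.
  rewrite expr0 mul1r addn0 => ->; congr (_ + _); first by rewrite mulr_natl.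
  by apply: eq_bigr => k _; rewrite mulr_natl.
have := jetD (jetM h01 (jm2 n) (jet_bounded (g_bounded n))) (jetD jpart2 small_rest).
move=> /eq_jet; apply => x.
- rewrite (_ : S x * W x * T x * star (W x) = x0 x + x1 x + x2 x).
    rewrite power_expansion !(linearD tau) /= tau_part1 addr0 /x0 exprZn linearZ /=.
    by rewrite addrA.
  have expand (a b u v : A) c : a * (u + c *: 1) * b * (v + c *: 1) =
      c ^+ 2 *: (a * b) + c *: (a * u * b + a * b * v) + a * u * b * v.
    rewrite [a * _]mulrDr mulrDl mulrDr !mulrDl -!(scalerAl, scalerAr) !mulr1.
    rewrite scalerA -expr2 [X in _ = _ + X + _]scalerDr.
    by rewrite [LHS](AC (2*2) (4*(3*2)*1)).
  have WE b : adj star b (W x) = adj star b (w x) + m x *: 1 by rewrite adj_w subrK.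
  by rewrite [star (W x)](WE true) [W x](WE false) expand.
- by rewrite mul1r !addr0.
- by rewrite addr0 mul1r; ring.
Qed.

End OneStep.

(** * The one-step estimate for the free unitary Brownian motion *)

Section Evolution.
Context {R : realType} {A : algType R[i]} {star : A -> A} {tau : {scalar A}}.
Context {P : A} {Y : R -> A}.
Hypothesis prob : is_wstar_probability_space star tau.
Hypothesis projP : is_projection star P.
Hypothesis brownian : is_free_unitary_brownian_motion star tau Y.
Hypothesis freePY : star_free_from_process star tau P Y.

Let S : A := 2 * P - 1.
Let kappa : R[i] := tau S.
Let U (t : R) : A := S * Y t * S * star (Y t).

Let inv : is_involution star. Proof. by have [] := wstar_vn prob. Qed.
Let tau1 := state1 prob.
Let tau_ge0 := state_ge0 prob.
Let tau_mulC := state_trace prob.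

Lemma symmetry_sqr : S * S = 1.
Proof.
have [_ PP] := projP.
rewrite /S mulr_natl mulr2n mulrBr mulr1 mulrBl mul1r !mulrDl !mulrDr PP.
by rewrite addrK opprB addrC subrK.
Qed.

Lemma symmetry_sa : star S = S.
Proof.
have [sP _] := projP; rewrite /S starB// star1// (starM inv) sP.
have -> : star 2 = 2 by rewrite (starD inv) star1.
by rewrite mulr_natl mulr_natr.
Qed.

Lemma symmetry_unitary : is_unitary star S.
Proof. by split; rewrite symmetry_sa symmetry_sqr. Qed.

Let Yu t : 0 <= t -> is_unitary star (Y t). Proof. exact: (fubm_unitary brownian). Qed.

Lemma is_unitary_spectral t : 0 <= t -> is_unitary star (U t).
Proof.
move=> t0; have Su := symmetry_unitary.
apply: is_unitaryM => //; last by apply: is_unitary_star => //; exact: Yu.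
by apply: is_unitaryM => //; apply: is_unitaryM => //; exact: Yu.
Qed.

(** With [Z = Y t * S * star (Y t)], the unitary is [S * Z] and its adjoint is [Z * S]; their powers
    are cyclically equivalent. This is needed because the Herglotz kernel expands in powers of the
    inverse. *)
Lemma tau_unitary_power_star t n :
  tau (star (U t) ^+ n) = tau (U t ^+ n).
Proof.
have -> : star (U t) = Y t * S * star (Y t) * S.
  by rewrite /U !(starM inv) (starK inv) symmetry_sa !mulrA.
have -> : U t = S * (Y t * S * star (Y t)) by rewrite /U !mulrA.
set Z := Y t * S * star (Y t).
have ZS k : Z * (S * Z) ^+ k = (Z * S) ^+ k * Z.
  elim: k => [|k IH]; first by rewrite !expr0 mulr1 mul1r.
  by rewrite exprSr mulrA IH exprSr !mulrA.
case: n => [|n]; first by rewrite !expr0.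
by rewrite exprSr mulrA -ZS tau_mulC mulrA -exprS.
Qed.

(** Steps are positive because freeness of increments concerns strictly increasing times, and at
    most 1 so that higher powers of the step are smaller. *)
Let X : Type := {x : R * R | (0 <= x.1) && (0 < x.2 <= 1)}.
Let time (x : X) : R := (sval x).1.
Let step (x : X) : R := (sval x).2.

Let time_ge0 x : 0 <= time x. Proof. by have /and3P[] := svalP x. Qed.
Let step_gt0 x : 0 < step x. Proof. by have /and3P[] := svalP x. Qed.
Let step01 x : 0 <= step x <= 1.
Proof. by have /and3P[_ h0 ->] := svalP x; rewrite andbT; exact: ltW. Qed.

Let W (x : X) : A := Y (time x + step x) * star (Y (time x)).
Let T (x : X) : A := Y (time x) * S * star (Y (time x)).

Let tauW x k : k != 0 ->
  tau (unitary_power star (W x) k) = (free_brownian_moment (step x) `|k|)%:C%C.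
Proof.
move=> k0; have lt_step : time x < time x + step x by rewrite ltrDl.
have := fubm_stationary brownian (time_ge0 x) lt_step.
rewrite -/(W x) [_ + _ - _]addrAC subrr add0r => law.
have moment b u n : star_moment star tau u (nseq n b) = tau (adj star b u ^+ n).
  congr (tau _); elim: n => [|n IH]; first by rewrite big_nil.
  by rewrite /= big_cons IH exprS.
have step0 : 0 <= step x by exact/ltW.
case: k k0 => n n0.
  by rewrite -[LHS](moment false) law moment (fubm_moment brownian)// lt0n.
by rewrite -[LHS](moment true _ n.+1) law moment (fubm_moment_star brownian).
Qed.

Definition spectral_slope (n : nat) (t : R) : R[i] :=
  - n%:R * tau (U t ^+ n) + n%:R * kappa ^+ 2 +
  \sum_(k < n) (n - k.+1)%:R *
    (2 * kappa ^+ 2 - 2 * (tau (U t ^+ k.+1) * tau (U t ^+ (n - k.+2).+1))).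

Lemma spectral_one_step n : exists2 C : R[i], 0 <= C &
  forall t h, 0 <= t -> 0 < h <= 1 ->
  `|tau (U (t + h) ^+ n) - (tau (U t ^+ n) + spectral_slope n t * h%:C%C)|
     <= C * h%:C%C ^+ 2.
Proof.
have ST x : S * T x = U (time x) by rewrite /T !mulrA.
have SWT x : S * W x * T x * star (W x) = U (time x + step x).
  have [_ YY] := Yu (time_ge0 x).
  rewrite /W /T (starM inv) (starK inv) /U !mulrA.
  by rewrite -!(mulrA _ (star (Y (time x))) (Y (time x))) YY !mulr1.
have Wu x : is_unitary star (W x).
  by apply: is_unitaryM => //; [|apply: is_unitary_star => //]; apply: Yu; rewrite ?addr_ge0// ltW.
have Tu x : is_unitary star (T x).
  have Yx := Yu (time_ge0 x); apply: is_unitaryM => //; last exact: is_unitary_star.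
  by apply: is_unitaryM => //; exact: symmetry_unitary.
pose B x := increment_split (star := star) (tau := tau) (P := P) (Y := Y) (time x) (step x).
have BM x b u v : B x b u -> B x b v -> B x b (u * v) by exact: increment_splitM.
have Blin x b c u v : B x b u -> B x b v -> B x b (c *: u + v) by exact: increment_split_lin.
have B1 x b : B x b 1 by exact: increment_split1.
have BS x : B x true S.
  have BP : B x true P by exact: increment_split_proj.
  rewrite /S mulr_natl addrC mulr2n -{1}[P]scale1r -scaleN1r.
  exact: (Blin _ _ _ _ _ (B1 x true) (Blin _ _ _ _ _ BP BP)).
have [BY BYs] : (forall x, B x true (Y (time x))) /\ (forall x, B x true (star (Y (time x)))).
  by split=> x; have [] := @increment_split_past R A star tau P Y tau1 (time x) (step x).
have BT x : B x true (T x) by exact: (BM _ _ _ _ (BM _ _ _ _ (BY x) (BS x)) (BYs x)).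
have T2 x : T x * T x = 1.
  have [YY' YY] := Yu (time_ge0 x); rewrite /T !mulrA.
  by rewrite -(mulrA _ (star (Y (time x))) (Y (time x))) YY mulr1 -(mulrA _ S S) symmetry_sqr mulr1.
have tauT x : tau (T x) = kappa.
  by have [_ YY] := Yu (time_ge0 x); rewrite /T -mulrA tau_mulC -mulrA YY mulr1.
have freeB x : free_family tau (B x).
  exact (free_increment_split tau1 brownian freePY (time_ge0 x) (step_gt0 x)).
have BW x : B x false (W x) /\ B x false (star (W x)).
  exact (@increment_split_future R A star tau P Y tau1 (time x) (step x)).
have Su (_ : X) : is_unitary star S := symmetry_unitary.
have [_ _ [C C0 bound]] := jet_one_step inv step01 tau1 tau_ge0 tau_mulC freeB B1 Blin BM
  Wu BW tauW Su Tu BS BT (fun=> symmetry_sqr) T2 (fun=> erefl) tauT n.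
exists C => // t h t0 h01.
have xP : (0 <= (t, h).1) && (0 < (t, h).2 <= 1) by rewrite t0.
by have := bound (exist _ (t, h) xP); rewrite SWT ST.
Qed.

End Evolution.

(** * Complex series *)

Section ComplexSeries.
Context {R : realType}.
Implicit Types (a l : nat -> R[i]) (b : nat -> R).

Definition summable_bound b : Prop :=
  (forall n, 0 <= b n) /\ exists K, forall N, \sum_(n < N) b n <= K.

Lemma summable_boundZ b (c : R) : 0 <= c -> summable_bound b ->
  summable_bound (fun n => c * b n).
Proof.
move=> c0 [b0 [K bK]]; split=> [n|]; first exact: mulr_ge0.
by exists (c * K) => N; rewrite -mulr_sumr ler_wpM2l.
Qed.

Lemma summable_bound_le b b' : (forall n, 0 <= b' n <= b n) -> summable_bound b ->
  summable_bound b'.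
Proof.
move=> bb [b0 [K bK]]; split=> [n|]; first by have /andP[] := bb n.
exists K => N; apply: le_trans (bK N); apply: ler_sum => n _.
by have /andP[] := bb n.
Qed.

Lemma sum_split a N M : (N <= M)%N ->
  \sum_(n < M) a n = \sum_(n < N) a n + \sum_(N <= n < M) a n.
Proof. by move=> NM; rewrite -!(big_mkord xpredT) -big_cat_nat. Qed.

Lemma summable_tail b (e : R) : summable_bound b -> 0 < e ->
  exists N0, forall N M, (N0 <= N)%N -> \sum_(N <= n < M) b n <= e.
Proof.
move=> [b0 [K bK]] e0; pose s := sup (range (fun N => \sum_(n < N) b n)).
have hs : has_sup (range (fun N => \sum_(n < N) b n)).
  split; first by exists (\sum_(n < 0) b n), 0%N.
  by exists K => _ [N _ <-].
have [_ [N0 _ <-] sN0] := sup_adherent e0 hs.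
exists N0 => N M N0N; have [NM|/ltnW MN] := leqP N M; last by rewrite big_geq// ltW.
have : \sum_(n < M) b n <= s by apply: sup_upper_bound => //; exists M.
rewrite -(big_mkord xpredT) (@big_cat_nat _ _ _ N)//= (@big_cat_nat _ _ _ N0 0%N N)//=.
have : 0 <= \sum_(N0 <= n < N) b n by apply: sumr_ge0.
by move: sN0; rewrite -(big_mkord xpredT) -/s; lra.
Qed.

Lemma cvg_dist_le (u : nat -> R[i]) (G c B : R[i]) N0 :
  u N @[N --> \oo] --> G -> (forall N, (N0 <= N)%N -> `|u N - c| <= B) ->
  `|G - c| <= B.
Proof.
move=> uG ub; apply/ler_addgt0Pr => e e0.
have /cvgrPdist_lt/(_ e e0)[N1 _ uN1] := uG.
pose N := maxn N0 N1.
have -> : G - c = (u N - c) + (G - u N) by ring.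
apply: le_trans (ler_normD _ _) _; apply: lerD; first by apply: ub; rewrite leq_maxl.
by apply: ltW; apply: uN1; rewrite /= leq_maxr.
Qed.

Lemma norm_sum_tail a b N M : (forall n, `|a n| <= (b n)%:C%C) -> 
  `|\sum_(N <= n < M) a n| <= (\sum_(N <= n < M) b n)%:C%C.
Proof.
move=> ab; apply: le_trans (ler_norm_sum _ _ _) _.
by rewrite (rmorph_sum (real_complex R)) /=; apply: ler_sum.
Qed.

Section ComplexLimits.
Context {T : Type} {F : set_system T} {FF : Filter F}.
Implicit Types (u v : T -> R[i]) (x y c : R[i]).

Lemma ccvg_cst c : (fun _ : T => c) x @[x --> F] --> c.
Proof. exact: cvg_cst. Qed.

Lemma ccvgD u v x y : u t @[t --> F] --> x -> v t @[t --> F] --> y ->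
  u t + v t @[t --> F] --> x + y.
Proof. by move=> ux vy; exact: (cvgD ux vy). Qed.

Lemma ccvgB u v x y : u t @[t --> F] --> x -> v t @[t --> F] --> y ->
  u t - v t @[t --> F] --> x - y.
Proof. by move=> ux vy; exact: (cvgB ux vy). Qed.

Lemma ccvgM u v x y : u t @[t --> F] --> x -> v t @[t --> F] --> y ->
  u t * v t @[t --> F] --> x * y.
Proof. by move=> ux vy; exact: (cvgM ux vy). Qed.

Lemma ccvgZ c u x : u t @[t --> F] --> x -> c * u t @[t --> F] --> c * x.
Proof. move=> ux. exact (ccvgM (ccvg_cst (c := c)) ux). Qed.

End ComplexLimits.

Lemma cvg_psum (T : Type) (F : set_system T) {FF : Filter F} (a : nat -> T -> R[i]) l N :
  (forall n, a n x @[x --> F] --> l n) ->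
  \sum_(n < N) a n x @[x --> F] --> \sum_(n < N) l n.
Proof.
move=> al; elim: N => [|N IH].
  by under eq_fun do rewrite big_ord0; rewrite big_ord0; exact: ccvg_cst.
rewrite (_ : (fun x => _) = fun x => \sum_(n < N) a n x + a N x); last first.
  by apply/funext => x; rewrite big_ord_recr.
by rewrite big_ord_recr; exact: (ccvgD IH (al N)).
Qed.

(** Dominated convergence for series, along an arbitrary filter: it serves the derivatives in [t]
    and in [z] as well as the Cauchy product. A common tail bound reduces everything to a finite
    sum. *)
Lemma tannery (T : Type) (F : set_system T) {FF : Filter F} (a : nat -> T -> R[i]) l b
    (G : T -> R[i]) (L : R[i]) :
  summable_bound b ->
  (forall n, a n x @[x --> F] --> l n) ->
  (\forall x \near F, forall n, `|a n x| <= (b n)%:C%C) ->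
  (\forall x \near F, \sum_(n < N) a n x @[N --> \oo] --> G x) ->
  \sum_(n < N) l n @[N --> \oo] --> L ->
  G x @[x --> F] --> L.
Proof.
move=> sb al ab aG lL; apply/cvgrPdist_lt => e e0.
have e40 : 0 < e / 4 by rewrite divr_gt0.
have er : exists2 d : R, 0 < d & d%:C%C = e / 4.
  have /RRe_real eE := gtr0_real e40; exists (complex.Re (e / 4)) => //.
  by rewrite -ltcR eE.
have [d d0 de] := er.
have [N0 tailN0] := summable_tail sb d0.
have /cvgrPdist_lt/(_ _ e40)[N1 _ lN1] := lL.
pose N := maxn N0 N1.
have finite_sum : \sum_(n < N) a n x @[x --> F] --> \sum_(n < N) l n.
  exact: cvg_psum.
have /cvgrPdist_lt/(_ _ e40) near_sum := finite_sum.
near=> x.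
have aGx : \sum_(n < M) a n x @[M --> \oo] --> G x by near: x.
have abx n : `|a n x| <= (b n)%:C%C by move: n; near: x.
have G_sum : `|G x - \sum_(n < N) a n x| <= d%:C%C.
  apply: (@cvg_dist_le (fun M => \sum_(n < M) a n x) _ _ _ N aGx).
  move=> M NM; rewrite (sum_split (fun n => a n x) NM) addrAC subrr add0r.
  apply: le_trans (norm_sum_tail N M abx) _.
  by rewrite lecR; apply: tailN0; rewrite leq_maxl.
have L_sum : `|L - \sum_(n < N) l n| < e / 4 by apply: lN1; rewrite /= leq_maxr.
have l_a : `|\sum_(n < N) l n - \sum_(n < N) a n x| < e / 4 by near: x.
have -> : L - G x = (L - \sum_(n < N) l n) + (\sum_(n < N) l n - \sum_(n < N) a n x)
   - (G x - \sum_(n < N) a n x) by ring.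
apply: le_lt_trans (ler_normB _ _) _.
apply: le_lt_trans (lerD (ler_normD _ _) (lexx _)) _.
rewrite de in G_sum; apply: lt_le_trans (ltr_leD (ltrD L_sum l_a) G_sum) _.
have -> : e / 4 + e / 4 + e / 4 = e - e / 4 by field.
by rewrite lerBlDr lerDl ltW.
Unshelve. all: by end_near. Qed.

Lemma summable_cvg0 a b : summable_bound b -> (forall n, `|a n| <= (b n)%:C%C) ->
  a n @[n --> \oo] --> 0.
Proof.
move=> sb ab; apply/cvgrPdist_lt => e e0.
have /RRe_real eE := gtr0_real e0.
have d0 : 0 < complex.Re e / 2 by rewrite divr_gt0// -ltcR eE.
have [N0 tailN0] := summable_tail sb d0; exists N0 => // n /= N0n.
rewrite sub0r normrN; apply: le_lt_trans (ab n) _; rewrite -eE ltcR.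
have := tailN0 n n.+1 N0n; rewrite big_nat1 => /le_lt_trans; apply.
by rewrite ltr_pdivrMr// ltr_pMr ?ltr1n// -ltcR eE.
Qed.

Lemma summable_real_cvg (u : nat -> R) b : summable_bound b -> (forall n, `|u n| <= b n) ->
  cvgn (series u).
Proof.
move=> [b0 [K bK]] ub; apply: normed_cvg.
have cb : cvgn (series b).
  apply: nondecreasing_is_cvgn.
    by apply/nondecreasing_seqP => n; rewrite /series /= big_nat_recr//= lerDl.
  by exists K => _ [N _ <-]; rewrite /series /= big_mkord.
exact: (series_le_cvg (fun n => normr_ge0 (u n)) b0 ub cb).
Qed.

Lemma norm_complex_le (p q : R) : `|(p +i* q)%C| <= (`|p| + `|q|)%:C%C :> R[i].
Proof.
rewrite normc_def /= lecR -[leRHS]ger0_norm ?addr_ge0// -sqrtr_sqr ler_wsqrtr//.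
by rewrite sqrrD !real_normK ?num_real// addrAC lerDl mulrn_wge0// mulr_ge0.
Qed.

Lemma norm_Re_le (z : R[i]) : `|complex.Re z|%:C%C <= `|z|.
Proof. by case: z => p q; rewrite normc_def /= lecR -sqrtr_sqr ler_wsqrtr// lerDl sqr_ge0. Qed.

Lemma norm_Im_le (z : R[i]) : `|complex.Im z|%:C%C <= `|z|.
Proof. by case: z => p q; rewrite normc_def /= lecR -sqrtr_sqr ler_wsqrtr// lerDr sqr_ge0. Qed.

Lemma cvg_complex (u v : nat -> R) (x y : R) :
  u n @[n --> \oo] --> x -> v n @[n --> \oo] --> y ->
  (u n +i* v n)%C @[n --> \oo] --> (x +i* y)%C.
Proof.
move=> ux vy; apply/cvgrPdist_lt => e e0.
have /RRe_real eE := gtr0_real e0.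
have d0 : 0 < complex.Re e / 2 by rewrite divr_gt0// -ltcR eE.
have /cvgrPdist_lt/(_ _ d0) nu := ux; have /cvgrPdist_lt/(_ _ d0) nv := vy.
near=> n.
have -> : ((x +i* y) - (u n +i* v n) = (x - u n) +i* (y - v n))%C by [].
apply: le_lt_trans (norm_complex_le _ _) _; rewrite -eE ltcR.
have xu : `|x - u n| < complex.Re e / 2 by near: n.
have yv : `|y - v n| < complex.Re e / 2 by near: n.
by apply: lt_le_trans (ltrD xu yv) _; rewrite -splitr.
Unshelve. all: by end_near. Qed.

Lemma summable_cvg a b : summable_bound b -> (forall n, `|a n| <= (b n)%:C%C) ->
  exists L : R[i], \sum_(n < N) a n @[N --> \oo] --> L.
Proof.
move=> sb ab.
have reb n : `|complex.Re (a n)| <= b n by rewrite -lecR; apply: le_trans (norm_Re_le _) (ab n).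
have imb n : `|complex.Im (a n)| <= b n by rewrite -lecR; apply: le_trans (norm_Im_le _) (ab n).
have rec := summable_real_cvg sb reb; have imc := summable_real_cvg sb imb.
exists (limn (series (fun n => complex.Re (a n))) +i* limn (series (fun n => complex.Im (a n))))%C.
have -> : (fun N => \sum_(n < N) a n) = fun N =>
   (series (fun n => complex.Re (a n)) N +i* series (fun n => complex.Im (a n)) N)%C.
  apply/funext => N; rewrite /series /= !big_mkord.
  elim: N => [|N IH]; first by rewrite !big_ord0.
  by rewrite !big_ord_recr /= IH; case: (a N).
exact: cvg_complex.
Qed.

Lemma geometric_sum (K : pzRingType) (z : K) N :
  (1 - z) * \sum_(n < N) z ^+ n = 1 - z ^+ N.
Proof. by rewrite -[1 - z]opprB mulNr -subrX1 opprB. Qed.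

(** Pascal's rule, with the boundary term kept explicit; it lowers [k] by one both when bounding the
    partial sums and when computing their limit. *)
Lemma binomial_sum_step (K : comPzRingType) (z : K) k N :
  (1 - z) * \sum_(n < N) 'C(n + k.+1, k.+1)%:R * z ^+ n =
  \sum_(n < N) 'C(n + k, k)%:R * z ^+ n - 'C(N + k, k.+1)%:R * z ^+ N.
Proof.
elim: N => [|N IH]; first by rewrite !big_ord0 mulr0 add0n bin_small// mul0r subrr.
rewrite !big_ord_recr /= mulrDr IH addSn addnS !binS !natrD exprS.
by ring.
Qed.

Lemma summable_binomial (r : R) k : 0 <= r < 1 ->
  summable_bound (fun n => 'C(n + k, k)%:R * r ^+ n).
Proof.
move=> /andP[r0 r1]; have d0 : 0 < 1 - r by rewrite subr_gt0.
elim: k => [|k [b0 [K bK]]]; split.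
- by move=> n; rewrite mulr_ge0// exprn_ge0.
- exists (1 - r)^-1 => N; rewrite -[leRHS]mul1r ler_pdivlMr//.
  under eq_bigr do rewrite bin0 mul1r.
  by rewrite mulrC geometric_sum gerBl exprn_ge0.
- by move=> n; rewrite mulr_ge0// exprn_ge0.
- exists (K / (1 - r)) => N; rewrite ler_pdivlMr// mulrC binomial_sum_step.
  by apply: le_trans (bK N); rewrite gerBl mulr_ge0// exprn_ge0.
Qed.

Lemma norm_lt1_real (z : R[i]) : `|z| < 1 -> exists2 r : R, 0 <= r < 1 & `|z| = r%:C%C.
Proof.
move=> z1; have /RRe_real zE := normr_real z; exists (complex.Re `|z|) => //.
by apply/andP; split; [rewrite -lecR zE; exact: normr_ge0|rewrite -ltcR zE].
Qed.

Lemma cvg_binomial_series (z : R[i]) k : `|z| < 1 ->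
  \sum_(n < N) 'C(n + k, k)%:R * z ^+ n @[N --> \oo] --> (1 - z)^-1 ^+ k.+1.
Proof.
move=> z1; have z0 : 1 - z != 0.
  by apply: contraTneq z1 => /eqP; rewrite subr_eq0 => /eqP <-; rewrite normr1 ltxx.
have [r r01 zr] := norm_lt1_real z1.
have norm_term j n : `|'C(n + j, j)%:R * z ^+ n| = ('C(n + j, j)%:R * r ^+ n)%:C%C.
  by rewrite normrM normrX zr normr_nat (rmorphM (real_complex R)) rmorphXn /= rmorph_nat.
elim: k => [|k IH].
  have zn : z ^+ n @[n --> \oo] --> 0.
    apply: (summable_cvg0 (summable_binomial 0 r01)) => n.
    by rewrite -norm_term bin0 mul1r.
  have -> : (fun N => \sum_(n < N) 'C(n + 0, 0)%:R * z ^+ n) = fun N => (1 - z)^-1 * (1 - z ^+ N).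
    apply/funext => N; under eq_bigr do rewrite bin0 mul1r.
    by apply: (mulfI z0); rewrite mulVKf// geometric_sum.
  have : (1 - z)^-1 * (1 - z ^+ N) @[N --> \oo] --> (1 - z)^-1 * (1 - 0).
    by apply: ccvgZ; exact: (ccvgB (ccvg_cst (c := 1)) zn).
  by rewrite subr0 mulr1 expr1.
have last0 : 'C(N + k, k.+1)%:R * z ^+ N @[N --> \oo] --> 0.
  apply: (summable_cvg0 (summable_binomial k.+1 r01)) => n.
  rewrite -norm_term !normrM !normr_nat ler_wpM2r// ler_nat.
  by rewrite addnS binS leq_addr.
have -> : (fun N => \sum_(n < N) 'C(n + k.+1, k.+1)%:R * z ^+ n) =
    fun N => (1 - z)^-1 * (\sum_(n < N) 'C(n + k, k)%:R * z ^+ n - 'C(N + k, k.+1)%:R * z ^+ N).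
  by apply/funext => N; rewrite -binomial_sum_step mulKf.
rewrite exprS -[X in _ * X]subr0.
by apply: ccvgZ; exact: (ccvgB IH last0).
Qed.

Lemma cauchy_sum (K : pzRingType) (u v : nat -> K) N :
  \sum_(n < N) \sum_(j < n.+1) u j * v (n - j)%N =
  \sum_(j < N) u j * \sum_(i < N - j) v i.
Proof.
elim: N => [|N IH]; first by rewrite !big_ord0.
rewrite !big_ord_recr /= IH subnn subSnn big_ord1 addrA; congr (_ + _).
rewrite -big_split /=; apply: eq_bigr => j _.
by rewrite subSn ?big_ord_recr ?mulrDr// ltnW.
Qed.

(** The N-th partial sum is the sum over j < N of [a j] times a partial sum of [c]. The latter are
    bounded by [K], so [tannery] applies with [N] as the parameter. *)
Lemma cvg_cauchy_product a c ab cb (x y : R[i]) :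
  summable_bound ab -> (forall n, `|a n| <= (ab n)%:C%C) ->
  summable_bound cb -> (forall n, `|c n| <= (cb n)%:C%C) ->
  \sum_(n < N) a n @[N --> \oo] --> x -> \sum_(n < N) c n @[N --> \oo] --> y ->
  \sum_(n < N) \sum_(j < n.+1) a j * c (n - j)%N @[N --> \oo] --> x * y.
Proof.
move=> sab aab [cb0 [K cbK]] ccb ax cy.
have -> : (fun N => \sum_(n < N) \sum_(j < n.+1) a j * c (n - j)%N) = fun N =>
    \sum_(j < N) a j * \sum_(i < N - j) c i by apply/funext => N; exact: cauchy_sum.
have K0 : 0 <= K by have := cbK 0%N; rewrite big_ord0.
have norm_B N : `|\sum_(i < N) c i| <= K%:C%C.
  rewrite -(big_mkord xpredT); apply: le_trans (norm_sum_tail 0 N ccb) _.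
  by rewrite lecR big_mkord.
apply: (@tannery _ \oo _ (fun j N => if (j < N)%N then a j * \sum_(i < N - j) c i else 0)
  (fun j => a j * y) (fun j => K * ab j)).
- exact: summable_boundZ.
- move=> j; have -> : (fun N => if (j < N)%N then a j * \sum_(i < N - j) c i else 0) =
      fun N => a j * (if (j < N)%N then \sum_(i < N - j) c i else 0).
    by apply/funext => N; case: ifP; rewrite ?mulr0.
  apply: ccvgZ; apply/cvgrPdist_lt => e e0; have /cvgrPdist_lt/(_ _ e0)[N1 _ cN1] := cy.
  exists (N1 + j).+1 => // N /= N1N; rewrite ifT; last by lia.
  by apply: cN1 => /=; lia.
- apply: nearW => N j; case: ifP => _; last first.
    by rewrite normr0 lecR mulr_ge0//; case: sab.
  by rewrite normrM mulrC (rmorphM (real_complex R)); apply: ler_pM.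
(* For fixed [N] the terms vanish from [j = N] on, so the partial sums are eventually constant. *)
- apply: nearW => N; apply: cvg_near_cst; exists N => // M /= NM.
  rewrite (sum_split (fun j => if (j < N)%N then a j * \sum_(i < N - j) c i else 0) NM).
  rewrite [X in _ + X]big1_seq ?addr0; last first.
    by move=> j /=; rewrite mem_index_iota => /andP[+ _]; rewrite leqNgt => /negbTE ->.
  by apply: eq_bigr => j _; rewrite ltn_ord.
- under eq_fun do rewrite -mulr_suml.
  exact: (ccvgM ax (ccvg_cst (c := y))).
Qed.

End ComplexSeries.

(** * From one-step estimates to derivatives *)

Section OneStepIntegration.
Context {R : realType}.
Implicit Types f g F : R -> R[i].

Definition bounded_lipschitz g : Prop :=
  exists2 C : R[i], 0 <= C & (forall t, 0 <= t -> `|g t| <= C) /\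
    (forall s t, 0 <= s -> 0 <= t -> `|g s - g t| <= C * `|s - t|%:C%C).

Let dist_ge0 (x : R) : 0 <= `|x|%:C%C :> R[i].
Proof. by rewrite lecR. Qed.

Lemma bounded_lipschitz_cst (c : R[i]) : bounded_lipschitz (fun=> c).
Proof.
by exists `|c| => //; split=> // s t _ _; rewrite subrr normr0 mulr_ge0.
Qed.

Lemma bounded_lipschitzD f g : bounded_lipschitz f -> bounded_lipschitz g ->
  bounded_lipschitz (fun t => f t + g t).
Proof.
move=> [C C0 [fC lf]] [D D0 [gD lg]]; exists (C + D); first exact: addr_ge0.
split=> [t t0|s t s0 t0]; first by apply: le_trans (ler_normD _ _) _; apply: lerD; auto.
by rewrite opprD addrACA mulrDl; apply: le_trans (ler_normD _ _) _; apply: lerD; auto.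
Qed.

Lemma bounded_lipschitzM f g : bounded_lipschitz f -> bounded_lipschitz g ->
  bounded_lipschitz (fun t => f t * g t).
Proof.
move=> [C C0 [fC lf]] [D D0 [gD lg]]; exists (C * D *+ 2).
  by rewrite mulrn_wge0// mulr_ge0.
split=> [t t0|s t s0 t0].
  rewrite normrM mulr2n -[leLHS]addr0; apply: lerD; last exact: mulr_ge0.
  by apply: ler_pM; auto.
have -> : f s * g s - f t * g t = (f s - f t) * g s + f t * (g s - g t) by ring.
apply: le_trans (ler_normD _ _) _; rewrite mulr2n (mulrDl (C * D)) !normrM; apply: lerD.
  by rewrite mulrAC; apply: ler_pM; auto.
by rewrite -mulrA; apply: ler_pM; auto.
Qed.

Lemma bounded_lipschitz_sum n (F : nat -> R -> R[i]) :
  (forall k, bounded_lipschitz (F k)) ->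
  bounded_lipschitz (fun t => \sum_(k < n) F k t).
Proof.
move=> Fl; elim: n => [|n IH].
  rewrite (_ : (fun _ => _) = fun=> 0); first exact: bounded_lipschitz_cst.
  by apply/funext => t; rewrite big_ord0.
rewrite (_ : (fun _ => _) = fun t => \sum_(k < n) F k t + F n t).
  exact: bounded_lipschitzD.
by apply/funext => t; rewrite big_ord_recr.
Qed.

Section OneStepScheme.
Variables (f F : R -> R[i]) (K : R).
Hypothesis FK : forall t, 0 <= t -> `|F t| <= K%:C%C.
Hypothesis one_step : exists2 C : R[i], 0 <= C &
  forall t h, 0 <= t -> 0 < h <= 1 ->
  `|f (t + h) - (f t + F t * h%:C%C)| <= C * h%:C%C ^+ 2.

(** Cutting the interval into N equal steps makes the quadratic errors add up to c h^2 / N only, so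
    the bound on [F] alone gives the Lipschitz constant, without any prior continuity of [f]. *)
Let lipschitz_right t h : 0 <= t -> 0 < h -> `|f (t + h) - f t| <= (K * h)%:C%C.
Proof.
move=> t0 h0; have [C C0 step] := one_step.
have /RRe_real cC := ger0_real C0; set c := complex.Re C in cC.
have c0 : 0 <= c by rewrite -lecR cC.
have step' s d : 0 <= s -> 0 < d <= 1 -> `|f (s + d) - f s| <= (K * d + c * d ^+ 2)%:C%C.
  move=> s0 d01; have d0 : 0 <= d by have /andP[/ltW] := d01.
  have -> : f (s + d) - f s = (f (s + d) - (f s + F s * d%:C%C)) + F s * d%:C%C by ring.
  apply: le_trans (ler_normD _ _) _; rewrite addrC (rmorphD (real_complex R)); apply: lerD.
    rewrite normrM (rmorphM (real_complex R)) [`|d%:C%C|]ger0_norm ?lecR//.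
    by apply: ler_wpM2r; [rewrite lecR|exact: FK].
  by rewrite (rmorphM (real_complex R)) rmorphXn /= cC; exact: step.
apply/ler_addgt0Pr => e e0; have /RRe_real eE := gtr0_real e0.
set d := complex.Re e in eE; have d0 : 0 < d by rewrite -ltcR eE.
rewrite -eE -(rmorphD (real_complex R)).
have ch0 : 0 <= c * h ^+ 2 / d by rewrite divr_ge0 ?mulr_ge0 ?exprn_ge0// ltW.
(* Large enough for h / N <= 1, where the one-step estimate holds, and for c h^2 / N <= d. *)
pose N := Num.bound (h + c * h ^+ 2 / d).
have Nh : h + c * h ^+ 2 / d <= N%:R.
  by apply/ltW/archi_boundP; rewrite addr_ge0// ltW.
have NR0 : 0 < N%:R :> R by apply: lt_le_trans Nh; rewrite ltr_pwDl.
have hN : 0 < h / N%:R <= 1.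
  by rewrite divr_gt0//= ler_pdivrMr// mul1r; apply: le_trans Nh; rewrite lerDl.
have -> : f (t + h) - f t =
    \sum_(0 <= i < N) (f (t + i.+1%:R * (h / N%:R)) - f (t + i%:R * (h / N%:R))).
  rewrite (telescope_sumr (fun i => f (t + i%:R * (h / N%:R))))// mul0r addr0.
  by rewrite mulrCA divff ?mulr1// gt_eqF.
apply: le_trans (ler_norm_sum _ _ _) _.
apply: (@le_trans _ _ (\sum_(0 <= i < N) (K * (h / N%:R) + c * (h / N%:R) ^+ 2)%:C%C)).
  apply: ler_sum => i _; rewrite -natr1 mulrDl mul1r addrA; apply: step' => //.
  by rewrite addr_ge0// mulr_ge0// ltW//; have /andP[] := hN.
rewrite sumr_const_nat subn0 -rmorphMn /= lecR -mulr_natl.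
have -> : N%:R * (K * (h / N%:R) + c * (h / N%:R) ^+ 2) = K * h + c * h ^+ 2 / N%:R.
  by field; rewrite gt_eqF.
rewrite lerD2l ler_pdivrMr// -ler_pdivrMl// mulrC.
by apply: le_trans Nh; rewrite lerDr ltW.
Qed.

Lemma one_step_lipschitz s t : 0 <= s -> 0 <= t -> `|f s - f t| <= K%:C%C * `|s - t|%:C%C.
Proof.
move=> s0 t0; rewrite -(rmorphM (real_complex R)) /=.
wlog ts : s t s0 t0 / t <= s => [hw|].
  have [/hw|/ltW st] := leP t s; first by apply.
  by rewrite distrC [`|s - t|]distrC; exact: hw.
move: ts; rewrite [t <= s]le_eqVlt => /predU1P[->|ts]; first by rewrite !subrr !normr0 mulr0.
rewrite [`|s - t|]ger0_norm ?subr_ge0 ?(ltW ts)//.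
by have := @lipschitz_right t (s - t) t0; rewrite addrCA subrr addr0 subr_gt0 => /(_ ts).
Qed.

(** For s < t the estimate is applied forward from [s], and [F s] is replaced by [F t] at a cost of
    order |s - t|^2, as [F] is Lipschitz. *)
Lemma one_step_derivative : bounded_lipschitz F ->
  exists2 D : R[i], 0 <= D & forall s t, 0 <= s -> 0 <= t -> `|s - t| <= 1 ->
  `|f s - f t - F t * (s - t)%:C%C| <= D * `|s - t|%:C%C ^+ 2.
Proof.
move=> [L L0 [_ lipF]]; have [C C0 step] := one_step.
exists (C + L); first exact: addr_ge0.
have right s t : 0 <= t -> t < s -> `|s - t| <= 1 ->
    `|f s - f t - F t * (s - t)%:C%C| <= C * `|s - t|%:C%C ^+ 2.
  move=> t0 ts; rewrite ger0_norm ?subr_ge0 ?(ltW ts)// => st1.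
  have := step t (s - t) t0; rewrite addrCA subrr addr0 opprD addrA; apply.
  by rewrite subr_gt0 ts.
move=> s t s0 t0 st1; have [st|ts|<-] := ltgtP s t; last 2 first.
- rewrite mulrDl -[leLHS]addr0; apply: lerD; first exact: right.
  by rewrite mulr_ge0// exprn_ge0.
- by rewrite !subrr mulr0 subrr normr0 mulr_ge0 ?addr_ge0// exprn_ge0.
have -> : f s - f t - F t * (s - t)%:C%C =
   - (f t - f s - F s * (t - s)%:C%C) + (F t - F s) * (t - s)%:C%C.
  by rewrite !(rmorphB (real_complex R)) /=; ring.
apply: le_trans (ler_normD _ _) _; rewrite normrN (mulrDl C L) [`|s - t|]distrC; apply: lerD.
  by apply: right => //; rewrite distrC.
rewrite normrM expr2 mulrA; apply: ler_pM => //; first exact: lipF.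
by rewrite ger0_norm ?lecR ?subr_ge0 ?(ltW st)// ger0_norm ?subr_ge0 ?(ltW st).
Qed.

End OneStepScheme.
End OneStepIntegration.

(** * The generating series *)

Section MomentEvolution.
Context {R : realType}.
Variables (f : nat -> R -> R[i]) (kappa : R[i]).

(** The formula of [spectral_slope] for an abstract sequence of functions; the analysis uses only
    the bounds and the one-step estimate assumed below. *)
Definition moment_slope (n : nat) (t : R) : R[i] :=
  - n%:R * f n t + n%:R * kappa ^+ 2 +
  \sum_(k < n) (n - k.+1)%:R *
    (2 * kappa ^+ 2 - 2 * (f k.+1 t * f (n - k.+2).+1 t)).

Hypothesis f0 : forall t, 0 <= t -> f 0 t = 1.
Hypothesis f1 : forall n t, 0 <= t -> `|f n t| <= 1.
Hypothesis kappa1 : `|kappa| <= 1.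
Hypothesis f_step : forall n, exists2 C : R[i], 0 <= C &
  forall t h, 0 <= t -> 0 < h <= 1 ->
  `|f n (t + h) - (f n t + moment_slope n t * h%:C%C)| <= C * h%:C%C ^+ 2.

Let kappa2 : `|kappa ^+ 2| <= 1. Proof. by rewrite normrX exprn_ile1. Qed.

(** The constant is 1 + 1 + 4: two terms of size at most n <= n^2, and n summands of size at most 4
    n. *)
Lemma norm_moment_slope n t : 0 <= t -> `|moment_slope n t| <= (6 * n%:R ^+ 2)%:C%C.
Proof.
move=> t0; have n_le : n%:R <= n%:R ^+ 2 :> R[i].
  by rewrite -natrX ler_nat -mulnn; case: n => // n; rewrite leq_pmulr.
apply: (@le_trans _ _ (n%:R + n%:R + n%:R * n%:R * 4)); last first.
  rewrite (rmorphM (real_complex R)) rmorphXn /= !rmorph_nat.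
  have -> : 6 * n%:R ^+ 2 = n%:R ^+ 2 + n%:R ^+ 2 + n%:R * n%:R * 4 :> R[i] by ring.
  by rewrite lerD2r; exact: lerD.
apply: le_trans (ler_normD _ _) _; apply: lerD.
  apply: le_trans (ler_normD _ _) _; apply: lerD; rewrite normrM ?normrN normr_nat.
    by rewrite ler_piMr// f1.
  by rewrite ler_piMr.
apply: le_trans (ler_norm_sum _ _ _) _.
apply: (@le_trans _ _ (\sum_(k < n) (n%:R * 4 : R[i]))); last first.
  by rewrite sumr_const card_ord -[_ *+ n]mulr_natl mulrA.
apply: ler_sum => k _; rewrite normrM normr_nat.
apply: ler_pM => //; first by rewrite ler_nat leq_subr.
have -> : 4 = 2 + 2 :> R[i] by ring.
apply: le_trans (ler_normB _ _) _; apply: lerD; rewrite normrM normr_nat ler_piMr//.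
by rewrite normrM mulr_ile1 ?f1.
Qed.

(** The convolution form, ready for a Cauchy product. The term [j = 0] accounts for the change from
    - n f_n to n f_n, and the coefficients of kappa^2 add up to n + n (n - 1). *)
Lemma moment_slopeE n t : 0 <= t ->
  moment_slope n t = n%:R * f n t -
    2 * (\sum_(j < n.+1) f j t * ((n - j)%:R * f (n - j) t)) + n%:R ^+ 2 * kappa ^+ 2.
Proof.
move=> t0; rewrite big_ord_recl /= f0// mul1r subn0.
have sum_n : \sum_(k < n) (n - k.+1)%:R * 2 = n%:R * (n%:R - 1) :> R[i].
  elim: n => [|n IH]; first by rewrite big_ord0 mul0r.
  rewrite big_ord_recr /= subnn mul0r addr0.
  rewrite (eq_bigr (fun k : 'I_n => (n - k.+1)%:R * 2 + 2)); last first.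
    by move=> k _; rewrite subSS -(subnSK (ltn_ord k)) -natr1; ring.
  by rewrite big_split /= IH sumr_const card_ord -mulr_natl -natr1; ring.
have -> : moment_slope n t = - n%:R * f n t + n%:R * kappa ^+ 2 +
    (\sum_(k < n) (n - k.+1)%:R * 2 * kappa ^+ 2 -
     \sum_(k < n) 2 * (f (bump 0 k) t * ((n - bump 0 k)%:R * f (n - bump 0 k) t))).
  rewrite /moment_slope -sumrB; congr (_ + _); apply: eq_bigr => k _.
  rewrite /bump /= add1n; have [kn|] := ltnP k.+1 n.
    by rewrite (subnSK kn); ring.
  by rewrite -subn_eq0 => /eqP ->; ring.
rewrite -mulr_suml sum_n -mulr_sumr; ring.
Qed.

Lemma bounded_lipschitz_moment n : bounded_lipschitz (f n).
Proof.
exists (1 + (6 * n%:R ^+ 2)%:C%C); first by rewrite addr_ge0// lecR mulr_ge0// exprn_ge0.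
have K0 : 0 <= (6 * n%:R ^+ 2)%:C%C :> R[i] by rewrite lecR mulr_ge0// exprn_ge0.
split=> [t t0|s t s0 t0]; first by apply: le_trans (f1 n t0) _; rewrite lerDl.
apply: le_trans (one_step_lipschitz (@norm_moment_slope n) (f_step n) s0 t0) _.
by apply: ler_wpM2r; rewrite ?lecR// lerDr.
Qed.

Lemma bounded_lipschitz_slope n : bounded_lipschitz (moment_slope n).
Proof.
have cst := @bounded_lipschitz_cst R; have fl := bounded_lipschitz_moment.
apply: bounded_lipschitzD.
  by apply: bounded_lipschitzD => //; exact: bounded_lipschitzM.
apply: (@bounded_lipschitz_sum _ _ (fun k t => (n - k.+1)%:R *
    (2 * kappa ^+ 2 - 2 * (f k.+1 t * f (n - k.+2).+1 t)))) => k.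
apply: bounded_lipschitzM => //.
rewrite (_ : (fun t => _) = fun t => 2 * kappa ^+ 2 + - 2 * (f k.+1 t * f (n - k.+2).+1 t)).
  apply: bounded_lipschitzD => //; apply: bounded_lipschitzM => //.
  exact: bounded_lipschitzM.
by apply/funext => t; rewrite mulNr.
Qed.

Local Notation nonneg_times t := (within [set h : R | 0 <= t + h] 0^').

Lemma cvg_moment_quotient n t : 0 <= t ->
  (f n (t + h) - f n t) / h%:C%C @[h --> nonneg_times t] --> moment_slope n t.
Proof.
move=> t0; have [D D0 dist] := one_step_derivative (f_step n)
  (bounded_lipschitz_slope n).
have /RRe_real dD := ger0_real D0; set d := complex.Re D in dD.
have d0 : 0 <= d by rewrite -lecR dD.
apply/cvgrPdist_lt => e e0; have /RRe_real eE := gtr0_real e0.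
set c := complex.Re e in eE; have c0 : 0 < c by rewrite -ltcR eE.
rewrite near_withinE; near=> h => th0.
have hn0 : h != 0 by near: h; exact: nbhs_dnbhs_neq.
have hC0 : h%:C%C != 0 :> R[i] by rewrite (fmorph_eq0 (real_complex R)).
have h1 : `|h| <= 1 by apply/ltW; near: h; exact: dnbhs0_lt.
have hc : (d + 1) * `|h| < c.
  rewrite mulrC -ltr_pdivlMr ?ltr_pwDr//.
  by near: h; apply: dnbhs0_lt; rewrite divr_gt0// ltr_pwDr.
have := dist (t + h) t th0 t0; rewrite [t + h - t]addrAC subrr add0r => /(_ h1) dh.
have -> : moment_slope n t - (f n (t + h) - f n t) / h%:C%C =
    - ((f n (t + h) - f n t - moment_slope n t * h%:C%C) / h%:C%C) by field.
rewrite normrN normrM normfV.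
have nh : `|h%:C%C| = `|h|%:C%C :> R[i] by rewrite normc_def /= expr0n addr0 sqrtr_sqr.
have nh0 : 0 < `|h|%:C%C :> R[i] by rewrite ltcR normr_gt0.
rewrite nh ltr_pdivrMr//; apply: le_lt_trans dh _.
rewrite expr2 mulrA ltr_pM2r// -eE -dD -(rmorphM (real_complex R)) ltcR.
by apply: le_lt_trans hc; rewrite ler_wpM2r// lerDl.
Unshelve. all: by end_near. Qed.

Variable G : R -> R[i] -> R[i].
Hypothesis G_series : forall t w, 0 <= t -> `|w| < 1 ->
  \sum_(n < N) f n t * w ^+ n @[N --> \oo] --> G t w.

Let dominated (a : R[i]) (c : R) (z : R[i]) (r : R) n :
  `|z| = r%:C%C -> `|a| <= c%:C%C -> `|a * z ^+ n| <= (c * r ^+ n)%:C%C.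
Proof.
move=> zr ac; rewrite normrM normrX zr (rmorphM (real_complex R)) rmorphXn /=.
by apply: ler_wpM2r => //; rewrite -zr exprn_ge0.
Qed.

Let summable_square (r : R) : 0 <= r < 1 -> summable_bound (fun n => 6 * n%:R ^+ 2 * r ^+ n).
Proof.
move=> r01; have r0 : 0 <= r by have /andP[] := r01.
(* Domination by 12 C(n+2,2) = 6 (n + 1) (n + 2). *)
have bin := summable_boundZ (ler0n R 12) (summable_binomial 2 r01).
apply: (summable_bound_le _ bin) => n.
rewrite !mulr_ge0 ?exprn_ge0//= mulrA ler_wpM2r ?exprn_ge0//.
have : 'C(n + 2, 2)%:R * 2 = (n%:R + 2) * (n%:R + 1) :> R.
  by rewrite mulrC -natrM -mul_bin_diag bin1 natrM addn2 -!natr1; ring.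
have : 0 <= n%:R :> R by [].
nra.
Qed.

Lemma cvg_square_series (z : R[i]) : `|z| < 1 ->
  \sum_(n < N) n%:R ^+ 2 * z ^+ n @[N --> \oo] --> z * (1 + z) / (1 - z) ^+ 3.
Proof.
move=> z1; have z0 : 1 - z != 0.
  by apply: contraTneq z1 => /eqP; rewrite subr_eq0 => /eqP <-; rewrite normr1 ltxx.
(* Decomposition n^2 = 2 C(n+2,2) - 3 C(n+1,1) + C(n,0). *)
have -> : (fun N => \sum_(n < N) n%:R ^+ 2 * z ^+ n) = fun N =>
    2 * (\sum_(n < N) 'C(n + 2, 2)%:R * z ^+ n) +
    (- 3 * (\sum_(n < N) 'C(n + 1, 1)%:R * z ^+ n) +
     \sum_(n < N) 'C(n + 0, 0)%:R * z ^+ n).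
  apply/funext => N; rewrite !mulr_sumr -!big_split /=; apply: eq_bigr => n _.
  have e : 2 * 'C(n + 2, 2)%:R = (n%:R + 2) * (n%:R + 1) :> R[i].
    by rewrite -natrM -mul_bin_diag bin1 natrM addn2 -!natr1; ring.
  by rewrite !mulrA e bin1 bin0 addn1 -natr1; ring.
rewrite (_ : z * (1 + z) / (1 - z) ^+ 3 =
  2 * (1 - z)^-1 ^+ 3 + (- 3 * (1 - z)^-1 ^+ 2 + (1 - z)^-1 ^+ 1)); last by field.
apply: ccvgD; first exact: (ccvgZ (cvg_binomial_series z1)).
by apply: ccvgD; [exact: (ccvgZ (cvg_binomial_series z1))|exact: cvg_binomial_series].
Qed.

Let ccvgX (T : Type) (F : set_system T) {FF : Filter F} (u : T -> R[i]) (x : R[i]) n :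
  u t @[t --> F] --> x -> u t ^+ n @[t --> F] --> x ^+ n.
Proof.
move=> ux; elim: n => [|n IH]; first exact: ccvg_cst.
rewrite exprS (_ : (fun t => _) = fun t => u t * u t ^+ n); first exact: (ccvgM ux IH).
by apply/funext => t; rewrite exprS.
Qed.

(** Quotients of powers expand as sums of (z + h)^(n-1-i) z^i, dominated by n rho^(n-1) near [z].
    The series is stated with sum [z * dG], the form met in the time derivative; [dG] cannot be
    recovered from it when z = 0. *)
Lemma space_derivative t z : 0 <= t -> `|z| < 1 -> exists dG : R[i],
  \sum_(n < N) n%:R * f n t * z ^+ n @[N --> \oo] --> z * dG /\
  (G t (z + h) - G t z) / h @[h --> 0^'] --> dG.
Proof.
move=> t0 z1; have [r r01 zr] := norm_lt1_real z1.
have [r0 r1] : 0 <= r /\ r < 1 by apply/andP.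
(* Midway between |z| and 1, so that |z + h| <= rho < 1 for all small [h]. *)
pose rho := (1 + r) / 2; have rho01 : 0 <= rho < 1 by rewrite /rho; apply/andP; split; lra.
have rho0 : 0 <= rho by have /andP[] := rho01.
have rrho : r <= rho by rewrite /rho; lra.
pose b n := n%:R * rho ^+ n.-1.
have b_sum : summable_bound b.
  split=> [n|]; first by rewrite mulr_ge0// exprn_ge0.
  have [_ [K bK]] := summable_binomial 1 rho01; exists K => -[|N].
    by have := bK 0%N; rewrite !big_ord0.
  rewrite big_ord_recl {1}/b mul0r add0r; apply: le_trans (bK N); apply: ler_sum => n _.
  by rewrite /b lift0 bin1 addn1.
pose a n h := f n t * \sum_(i < n) (z + h) ^+ (n.-1 - i) * z ^+ i.
pose l n := n%:R * f n t * z ^+ n.-1.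
have a_bound n h : `|z + h| <= rho%:C%C -> `|a n h| <= (b n)%:C%C.
  move=> zh; rewrite normrM -[leRHS]mul1r; apply: ler_pM => //; first exact: f1.
  apply: le_trans (ler_norm_sum _ _ _) _.
  rewrite (_ : (b n)%:C%C = \sum_(i < n) rho%:C%C ^+ n.-1); last first.
    by rewrite sumr_const card_ord /b (rmorphM (real_complex R)) rmorphXn /= rmorph_nat mulr_natl.
  apply: ler_sum => i _; rewrite normrM !normrX.
  have -> : n.-1 = (n.-1 - i + i)%N by rewrite subnK// -ltnS (ltn_predK (ltn_ord i)).
  rewrite addnK exprD; apply: ler_pM; rewrite ?exprn_ge0//; apply: lerXn2r => //.
  - by rewrite nnegrE lecR.
  - by rewrite nnegrE lecR.
  - by rewrite zr lecR.
have l_a0 n : l n = a n 0.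
  rewrite /l /a addr0 (eq_bigr (fun=> z ^+ n.-1)).
    by rewrite sumr_const card_ord -(mulr_natl (z ^+ n.-1)); ring.
  by move=> i _; rewrite -exprD subnK// -ltnS (ltn_predK (ltn_ord i)).
have [dG dG_lim] : exists dG : R[i], \sum_(n < N) l n @[N --> \oo] --> dG.
  apply: (summable_cvg b_sum) => n; rewrite l_a0; apply: a_bound.
  by rewrite addr0 zr lecR.
exists dG; split.
  have -> : (fun N => \sum_(n < N) n%:R * f n t * z ^+ n) = fun N => z * \sum_(n < N) l n.
    apply/funext => N; rewrite mulr_sumr; apply: eq_bigr => -[[|n] nN] _ /=.
      by rewrite /l !mul0r mulr0.
    by rewrite /l /= exprS; ring.
  exact: (ccvgZ dG_lim).
have zrho : `|z| + (rho - r)%:C%C <= rho%:C%C.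
  by rewrite zr -(rmorphD (real_complex R)) lecR addrC subrK.
have zrho1 : `|z| + (rho - r)%:C%C <= 1.
  by apply: le_trans zrho _; rewrite -[1](rmorph1 (real_complex R)) lecR /rho; lra.
have small_h : \forall h \near (0 : R[i])^', `|h| < (rho - r)%:C%C.
  by apply: dnbhs0_lt; rewrite ltcR /rho; lra.
apply: (tannery (a := a) b_sum _ _ _ dG_lim).
- move=> n; rewrite l_a0; apply: ccvgZ.
  apply: (cvg_psum (a := fun i h => (z + h) ^+ (n.-1 - i) * z ^+ i)
    (l := fun i => (z + 0) ^+ (n.-1 - i) * z ^+ i)) => i.
  have h0 : h @[h --> (0 : R[i])^'] --> (0 : R[i]) by exact: cvg_within.
  have zh : z + h @[h --> (0 : R[i])^'] --> z + 0 by exact: (ccvgD (ccvg_cst (c := z)) h0).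
  exact: (ccvgM (ccvgX (n := (n.-1 - i)%N) zh) (ccvg_cst (c := z ^+ i))).
- near=> h => n; apply: a_bound.
  have hs : `|h| < (rho - r)%:C%C by near: h.
  exact: (le_trans (ler_normD z h) (le_trans (lerD (lexx `|z|) (ltW hs)) zrho)).
- near=> h.
  have hn0 : h != 0 by near: h; exact: nbhs_dnbhs_neq.
  have hs : `|h| < (rho - r)%:C%C by near: h.
  have zh : `|z + h| < 1.
    exact: (le_lt_trans (ler_normD z h) (lt_le_trans (ler_ltD (lexx `|z|) hs) zrho1)).
  rewrite (_ : (fun N => _) = fun N => h^-1 * (\sum_(n < N) f n t * (z + h) ^+ n -
      \sum_(n < N) f n t * z ^+ n)).
    rewrite mulrC; apply: ccvgZ.
    exact: (ccvgB (G_series t0 zh) (G_series t0 z1)).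
  apply/funext => N; rewrite -sumrB mulr_sumr; apply: eq_bigr => n _.
  apply: (mulfI hn0); rewrite mulVKf// -mulrBr subrXX addrAC subrr add0r /a; ring.
Unshelve. all: by end_near. Qed.

(** The Lipschitz constants 6 n^2 dominate the difference quotients, uniformly in the step. The
    limit is then summed through [moment_slopeE], whose convolution becomes the product
    [G t z * zdG]. *)
Lemma time_derivative t z zdG : 0 <= t -> `|z| < 1 ->
  \sum_(n < N) n%:R * f n t * z ^+ n @[N --> \oo] --> zdG ->
  (G (t + h) z - G t z) / h%:C%C @[h --> nonneg_times t] -->
    zdG + - 2 * (G t z * zdG) + kappa ^+ 2 * (z * (1 + z) / (1 - z) ^+ 3).
Proof.
move=> t0 z1 zdG_lim; have [r r01 zr] := norm_lt1_real z1.
have [r0 r1] : 0 <= r /\ r < 1 by apply/andP.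
apply: (tannery (a := fun n h => (f n (t + h) - f n t) / h%:C%C * z ^+ n)
  (l := fun n => moment_slope n t * z ^+ n) (summable_square r01)).
- by move=> n; exact: (ccvgM (cvg_moment_quotient (n := n) t0) (ccvg_cst (c := z ^+ n))).
- rewrite near_withinE; near=> h => th0 n.
  have hn0 : h != 0 by near: h; exact: nbhs_dnbhs_neq.
  apply: dominated => //; rewrite normrM normfV.
  have -> : `|h%:C%C| = `|h|%:C%C :> R[i] by rewrite normc_def /= expr0n addr0 sqrtr_sqr.
  rewrite ler_pdivrMr; last by rewrite ltcR normr_gt0.
  have := one_step_lipschitz (@norm_moment_slope n) (f_step n) th0 t0.
  by rewrite [t + h - t]addrAC subrr add0r.
- rewrite near_withinE; near=> h => th0.
  rewrite (_ : (fun N => _) = fun N => (h%:C%C)^-1 *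
     (\sum_(n < N) f n (t + h) * z ^+ n - \sum_(n < N) f n t * z ^+ n)).
    rewrite mulrC; apply: ccvgZ; exact: (ccvgB (G_series th0 z1) (G_series t0 z1)).
  by apply/funext => N; rewrite -sumrB mulr_sumr; apply: eq_bigr => n _; ring.
rewrite (_ : (fun N => _) = fun N => (\sum_(n < N) n%:R * f n t * z ^+ n +
    - 2 * (\sum_(n < N) \sum_(j < n.+1) (f j t * z ^+ j) *
         ((n - j)%:R * f (n - j)%N t * z ^+ (n - j)))) +
    kappa ^+ 2 * (\sum_(n < N) n%:R ^+ 2 * z ^+ n)); last first.
  apply/funext => N; rewrite !mulr_sumr -!big_split /=; apply: eq_bigr => n _.
  rewrite moment_slopeE//.
  rewrite [X in - 2 * X](_ : _ =
      (\sum_(j < n.+1) f j t * ((n - j)%:R * f (n - j) t)) * z ^+ n); first by ring.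
  rewrite mulr_suml; apply: eq_bigr => j _.
  have -> : z ^+ n = z ^+ j * z ^+ (n - j) by rewrite -exprD subnKC// -ltnS ltn_ord.
  by ring.
apply: ccvgD; last exact: (ccvgZ (cvg_square_series z1)).
apply: ccvgD; first exact: zdG_lim.
apply: ccvgZ.
apply: (cvg_cauchy_product (a := fun j => f j t * z ^+ j)
  (c := fun i => i%:R * f i t * z ^+ i) (summable_binomial 0 r01) _
  (summable_binomial 1 r01) _ (G_series t0 z1) zdG_lim) => n.
  by rewrite bin0; apply: dominated => //; exact: f1.
apply: dominated => //; rewrite normrM normr_nat addn1 bin1 rmorph_nat.
apply: (@le_trans _ _ n%:R); first by rewrite ler_piMr// f1.
by rewrite ler_nat.
Unshelve. all: by end_near. Qed.

End MomentEvolution.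

Lemma is_derive_quotient (R : realType) (F : R[i] -> R[i]) (z d : R[i]) :
  (F (z + h) - F z) / h @[h --> 0^'] --> d -> is_derive z 1 F d.
Proof.
rewrite (_ : (fun h => _) = fun h => h^-1 *: ((F \o shift z) (h *: 1) - F z)); last first.
  by apply/funext => h; rewrite /= [h *: 1]mulr1 [h + z]addrC mulrC.
move=> Fd; apply: DeriveDef; first by apply/cvg_ex; exists d.
exact: (cvg_lim (@norm_hausdorff _ _)).
Qed.

Lemma cvg_quotient_sqr (R : realType) (F : R[i] -> R[i]) (z d : R[i]) :
  (F (z + h) - F z) / h @[h --> 0^'] --> d ->
  (F (z + h) ^+ 2 - F z ^+ 2) / h @[h --> 0^'] --> d * (2 * F z).
Proof.
move=> Fd; rewrite (_ : (fun h => _) = fun h => (F (z + h) - F z) / h *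
   ((F (z + h) - F z) / h * h + 2 * F z)); last first.
  (* The identity of functions is also checked at h = 0, where both numerators vanish. *)
  apply/funext => h; have [->|h0] := eqVneq h 0.
    by rewrite addr0 !subrr !mul0r.
  by field.
have h0 : h @[h --> (0 : R[i])^'] --> (0 : R[i]) by exact: cvg_within.
have -> : d * (2 * F z) = d * (d * 0 + 2 * F z) by ring.
exact: (ccvgM Fd (ccvgD (ccvgM Fd h0) (ccvg_cst (c := 2 * F z)))).
Qed.

(** * Integration on the circle *)

Section CircleIntegral.
Context {R : realType}.
Local Notation C := (borelC R).
Local Notation circle := (unit_circle R : set C).
Implicit Types f g : R[i] -> R[i].

Let Re (x : C) : R := complex.Re (x : R[i]).
Let Im (x : C) : R := complex.Im (x : R[i]).

Let open_measurable (U : set R[i]) : open U -> measurable (U : set C).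
Proof. by move=> oU; exact: sub_sigma_algebra. Qed.

Lemma measurable_real_lipschitz (p : R[i] -> R) :
  (forall x y, `|p x - p y|%:C%C <= `|x - y|) -> measurable_fun [set: C] (p : C -> R).
Proof.
move=> lip mT; apply: (measurability _ (RGenOInfty.measurableE R)) => //.
move=> /= _ [_ [a ->] <-]; rewrite setTI; apply: open_measurable.
rewrite openE => x; rewrite /preimage /= in_itv /= andbT => ax.
apply/nbhs_ballP; exists (p x - a)%:C%C => /=; first by rewrite ltcR subr_gt0.
move=> y; rewrite -ball_normE /= in_itv /= andbT => xy.
have : `|p x - p y| < p x - a by rewrite -ltcR; apply: le_lt_trans (lip x y) xy.
by rewrite ltr_norml; lra.
Qed.

Lemma measurable_Re : measurable_fun [set: C] Re.
Proof. by apply: measurable_real_lipschitz => x y; rewrite -raddfB norm_Re_le. Qed.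

Lemma measurable_Im : measurable_fun [set: C] Im.
Proof. by apply: measurable_real_lipschitz => x y; rewrite -raddfB norm_Im_le. Qed.

Lemma unit_circleE (x : R[i]) : unit_circle R x -> x * x^*%C = 1.
Proof. by move=> /= x1; rewrite -[RHS](expr1n _ 2) -x1 normCK. Qed.

Lemma measurable_unit_circle : measurable circle.
Proof.
have -> : circle = (fun x => Re x ^+ 2 + Im x ^+ 2) @^-1` [set 1].
  apply/seteqP; split=> x /=.
    move=> x1; have := unit_circleE x1; case: x {x1} => a b /eqP.
    by rewrite eq_complex /= => /andP[/eqP + _]; rewrite /Re /Im /= => <-; ring.
  case: x => a b; rewrite /Re /Im /= => ab.
  by rewrite /unit_circle /= normc_def /= ab sqrtr1.
rewrite -[X in measurable X]setTI; apply: measurable_funD => //.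
by apply: measurable_funX; exact: measurable_Re.
by apply: measurable_funX; exact: measurable_Im.
Qed.

(** Boundedness replaces integrability, since bounded measurable functions are closed under products
    and integrable against a probability. *)
Definition circle_integrable f : Prop :=
  [/\ measurable_fun circle (fun x : C => complex.Re (f x)),
      measurable_fun circle (fun x : C => complex.Im (f x)) &
      exists c : R, forall x, unit_circle R x -> `|f x| <= c%:C%C].

Lemma eq_circle_integrable f g : (forall x, unit_circle R x -> f x = g x) ->
  circle_integrable f -> circle_integrable g.
Proof.
move=> fg [mr mi [c fc]]; split; last by exists c => x x1; rewrite -fg//; exact: fc.
- by apply: eq_measurable_fun mr => x; rewrite inE => /fg ->.
- by apply: eq_measurable_fun mi => x; rewrite inE => /fg ->.
Qed.

Lemma circle_integrable_cst c : circle_integrable (fun=> c).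
Proof.
split; [exact: measurable_cst|exact: measurable_cst|].
by exists (complex.Re `|c|) => x _; rewrite RRe_real.
Qed.

Lemma circle_integrableD f g : circle_integrable f -> circle_integrable g ->
  circle_integrable (fun x => f x + g x).
Proof.
move=> [fr fi [c fc]] [gr gi [d gd]]; split.
- rewrite (_ : (fun x => _) = (fun x : C => complex.Re (f x)) \+ (fun x : C => complex.Re (g x))).
    exact: measurable_funD.
  by apply/funext => x; rewrite /= raddfD.
- rewrite (_ : (fun x => _) = (fun x : C => complex.Im (f x)) \+ (fun x : C => complex.Im (g x))).
    exact: measurable_funD.
  by apply/funext => x; rewrite /= raddfD.
exists (c + d) => x x1; rewrite (rmorphD (real_complex R)).
by apply: le_trans (ler_normD _ _) _; apply: lerD; [exact: fc|exact: gd].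
Qed.

Lemma circle_integrableM f g : circle_integrable f -> circle_integrable g ->
  circle_integrable (fun x => f x * g x).
Proof.
move=> [fr fi [c fc]] [gr gi [d gd]]; split.
- rewrite (_ : (fun x => _) =
    ((fun x : C => complex.Re (f x)) \* (fun x : C => complex.Re (g x))) \-
    ((fun x : C => complex.Im (f x)) \* (fun x : C => complex.Im (g x)))).
    by apply: measurable_funB; exact: measurable_funM.
  by apply/funext => x /=; case: (f x) (g x) => [? ?] [].
- rewrite (_ : (fun x => _) =
    ((fun x : C => complex.Re (f x)) \* (fun x : C => complex.Im (g x))) \+
    ((fun x : C => complex.Im (f x)) \* (fun x : C => complex.Re (g x)))).
    by apply: measurable_funD; exact: measurable_funM.
  by apply/funext => x /=; case: (f x) (g x) => [? ?] [].
exists (c * d) => x x1; rewrite normrM (rmorphM (real_complex R)).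
by apply: ler_pM => //; [exact: fc|exact: gd].
Qed.

Lemma circle_integrableX f n : circle_integrable f ->
  circle_integrable (fun x => f x ^+ n).
Proof.
move=> fI; elim: n => [|n IH]; first exact: circle_integrable_cst.
apply: eq_circle_integrable (circle_integrableM fI IH) => x _.
by rewrite exprS.
Qed.

Lemma circle_integrable_inv : circle_integrable (fun x => x^-1).
Proof.
(* On the circle the inverse is the conjugate. *)
apply: (@eq_circle_integrable (fun x => x^*%C)) => [x x1|].
  have xx := unit_circleE x1; have x0 : x != 0.
    by apply: contra_eq_neq xx => ->; rewrite mul0r eq_sym oner_eq0.
  by apply: (mulfI x0); rewrite xx divff.
split.
- rewrite (_ : (fun x => _) = Re); first exact: measurable_funTS measurable_Re.
  by apply/funext => -[].
- rewrite (_ : (fun x => _) = \- Im); last by apply/funext => -[].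
  by apply: measurable_funN; exact: measurable_funTS measurable_Im.
by exists 1 => x x1; rewrite norm_conjC x1.
Qed.

Lemma circle_integrable_limit (F : nat -> R[i] -> R[i]) f (b : nat -> R) (c : R) :
  (forall N, circle_integrable (F N)) ->
  (forall N x, unit_circle R x -> `|f x - F N x| <= (b N)%:C%C) ->
  b N @[N --> \oo] --> (0 : R) ->
  (forall x, unit_circle R x -> `|f x| <= c%:C%C) ->
  circle_integrable f.
Proof.
move=> FI fF b0 fc.
have lim (p : R[i] -> R) : (forall u v, `|p u - p v|%:C%C <= `|u - v|) ->
    forall x : C, circle x -> p (F N x) @[N --> \oo] --> p (f x).
  move=> lip x x1; apply/cvgrPdist_lt => e e0.
  have /cvgrPdist_lt/(_ _ e0)[N0 _ bN0] := b0; exists N0 => // N /bN0.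
  rewrite /= sub0r normrN => /(le_lt_trans (ler_norm _)); apply: le_lt_trans.
  by rewrite -lecR; apply: le_trans (lip _ _) (fF N x x1).
split; last by exists c.
- apply: (measurable_fun_cvg (h := fun N (x : C) => complex.Re (F N x))).
    by move=> N; have [] := FI N.
  by apply: lim => u v; rewrite -raddfB norm_Re_le.
- apply: (measurable_fun_cvg (h := fun N (x : C) => complex.Im (F N x))).
    by move=> N; have [] := FI N.
  by apply: lim => u v; rewrite -raddfB norm_Im_le.
Qed.

Variable mu : probability C R.
Hypothesis mu_circle : mu circle = 1%E.

Let bounded_integrable (p : C -> R) c : measurable_fun circle p ->
  (forall x, circle x -> `|p x| <= c) -> mu.-integrable circle (EFin \o p).
Proof.
move=> mp pc; apply: measurable_bounded_integrable => //.
- exact: measurable_unit_circle.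
- exact: (eq_ind_r (fun y => (y < +oo)%E) (ltry 1) mu_circle).
- exists c; split; first exact: num_real.
  by move=> M cM x /pc /le_trans; apply; exact: ltW.
Qed.

Let integrable_Re f : circle_integrable f ->
  mu.-integrable circle (EFin \o (fun x : C => complex.Re (f x))).
Proof.
move=> [mr _ [c fc]]; apply: (bounded_integrable (c := c)) => // x x1.
by rewrite -lecR; apply: le_trans (norm_Re_le _) (fc x x1).
Qed.

Let integrable_Im f : circle_integrable f ->
  mu.-integrable circle (EFin \o (fun x : C => complex.Im (f x))).
Proof.
move=> [_ mi [c fc]]; apply: (bounded_integrable (c := c)) => // x x1.
by rewrite -lecR; apply: le_trans (norm_Im_le _) (fc x x1).
Qed.

Lemma eq_circle_integral f g : (forall x, unit_circle R x -> f x = g x) ->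
  circle_integral mu f = circle_integral mu g.
Proof.
by move=> fg; rewrite /circle_integral; congr Complex;
  apply: eq_Rintegral => x; rewrite inE => x1; rewrite fg.
Qed.

Let Rintegral_circle_cst (c : R) : \int[mu]_(x in circle) c = c.
Proof.
rewrite Rintegral_cst; last exact: measurable_unit_circle.
by rewrite -[RHS]mulr1; congr (_ * _); exact: (congr1 fine mu_circle).
Qed.

Lemma circle_integral_cst c : circle_integral mu (fun=> c) = c.
Proof.
by rewrite /circle_integral !Rintegral_circle_cst; case: c.
Qed.

Lemma circle_integralD f g : circle_integrable f -> circle_integrable g ->
  circle_integral mu (fun x => f x + g x) = circle_integral mu f + circle_integral mu g.
Proof.
move=> fI gI; have mc := measurable_unit_circle.
rewrite /circle_integral; apply/eqP; rewrite eq_complex /=; apply/andP; split; apply/eqP.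
- rewrite -RintegralD//; try exact: integrable_Re.
  by apply: eq_Rintegral => x _; rewrite raddfD.
- rewrite -RintegralD//; try exact: integrable_Im.
  by apply: eq_Rintegral => x _; rewrite raddfD.
Qed.

Lemma circle_integralZ c f : circle_integrable f ->
  circle_integral mu (fun x => c * f x) = c * circle_integral mu f.
Proof.
move=> fI; have mc := measurable_unit_circle; case: c => a b.
have IR := integrable_Re fI; have II := integrable_Im fI.
have scale (p : C -> R) k : mu.-integrable circle (EFin \o p) ->
    mu.-integrable circle (EFin \o (fun x => k * p x)).
  by move=> Ip; rewrite (_ : _ \o _ = (fun x => k%:E * (EFin \o p) x)%E) //; exact: integrableZl.
rewrite /circle_integral; apply/eqP; rewrite eq_complex /=; apply/andP; split; apply/eqP.
- rewrite -!RintegralZl// -RintegralB//; try exact: scale.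
  by apply: eq_Rintegral => x _; case: (f x).
- rewrite -!RintegralZl// -RintegralD//; try exact: scale.
  by apply: eq_Rintegral => x _; case: (f x).
Qed.

(** The factor 2 comes from bounding the real and imaginary parts separately; only convergence to 0
    is drawn from it. *)
Lemma norm_circle_integral f (c : R) : circle_integrable f ->
  (forall x, unit_circle R x -> `|f x| <= c%:C%C) ->
  `|circle_integral mu f| <= (2 * c)%:C%C.
Proof.
move=> fI fc; have mc := measurable_unit_circle.
have bound (p : C -> R) : mu.-integrable circle (EFin \o p) ->
    (forall x, circle x -> `|p x| <= c) -> `|\int[mu]_(x in circle) p x| <= c.
  move=> Ip pc; apply: le_trans (le_normr_Rintegral mc Ip) _.
  rewrite -[leRHS]Rintegral_circle_cst; apply: le_Rintegral => //.
    by have := integrable_norm Ip.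
  exact: finite_measure_integrable_cst.
apply: le_trans (norm_complex_le _ _) _; rewrite lecR mulr_natl mulr2n; apply: lerD.
- apply: bound (integrable_Re fI) _ => x x1.
  by rewrite -lecR; apply: le_trans (norm_Re_le _) (fc x x1).
- apply: bound (integrable_Im fI) _ => x x1.
  by rewrite -lecR; apply: le_trans (norm_Im_le _) (fc x x1).
Qed.

End CircleIntegral.

(** * Power series of the Herglotz transform *)

Section HerglotzSeries.
Context {R : realType}.
Variable mu : probability (borelC R) R.
Hypothesis mu_circle : mu (unit_circle R) = 1%E.
Variable c : nat -> R[i].
Hypothesis moments : forall n, circle_integral mu (fun x => x^-1 ^+ n) = c n.

(** With q = z / x the Herglotz kernel is (1 + q) / (1 - q) = - 1 + 2 / (1 - q). Truncating the
    geometric series leaves the error 2 q^N / (1 - q), uniformly small on the circle. *)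
Let partial (z : R[i]) (N : nat) (x : R[i]) : R[i] :=
  -1 + 2 * \sum_(n < N) z ^+ n * x^-1 ^+ n.

Let term_integrable (a : R[i]) n : circle_integrable (fun x => a * x^-1 ^+ n).
Proof.
apply: (@circle_integrableM _ (fun=> a)); first exact: circle_integrable_cst.
apply: (@circle_integrableX _ (fun x => x^-1)); exact: circle_integrable_inv.
Qed.

Let sum_integrable (a : nat -> R[i]) N :
  circle_integrable (fun x => \sum_(n < N) a n * x^-1 ^+ n) /\
  circle_integral mu (fun x => \sum_(n < N) a n * x^-1 ^+ n) = \sum_(n < N) a n * c n.
Proof.
elim: N => [|N [IHi IHe]].
  rewrite (_ : (fun x => _) = fun=> 0); last by apply/funext => x; rewrite big_ord0.
  by rewrite big_ord0 circle_integral_cst//; split=> //; exact: circle_integrable_cst.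
rewrite (_ : (fun x => _) = fun x => \sum_(n < N) a n * x^-1 ^+ n + a N * x^-1 ^+ N); last first.
  by apply/funext => x; rewrite big_ord_recr.
have tN := term_integrable (a N) N; split; first exact: circle_integrableD.
rewrite circle_integralD// IHe big_ord_recr /=; congr (_ + _).
have invN : circle_integrable (fun x : R[i] => x^-1 ^+ N).
  by apply: eq_circle_integrable (term_integrable 1 N) => x _; rewrite mul1r.
by rewrite circle_integralZ// moments.
Qed.

Let partial_integrable z N : circle_integrable (partial z N) /\
  circle_integral mu (partial z N) = -1 + 2 * \sum_(n < N) z ^+ n * c n.
Proof.
have [si se] := sum_integrable (fun n => z ^+ n) N.
have I1 : circle_integrable (fun=> -1 : R[i]) := circle_integrable_cst (-1).
have I2 : circle_integrable (fun x => 2 * \sum_(n < N) z ^+ n * x^-1 ^+ n).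
  by apply: (@circle_integrableM _ (fun=> 2)) => //; exact: circle_integrable_cst.
split; first exact: circle_integrableD.
by rewrite circle_integralD// circle_integral_cst// circle_integralZ// se.
Qed.

Lemma herglotz_series (z : R[i]) : `|z| < 1 ->
  2 * (\sum_(n < N) c n * z ^+ n) - 1 @[N --> \oo] --> herglotz mu z.
Proof.
move=> z1; have [r r01 zr] := norm_lt1_real z1.
have [r0 r1] : 0 <= r /\ r < 1 by apply/andP.
have d0 : 0 < 1 - r by rewrite subr_gt0.
pose F (x : R[i]) := (x + z) / (x - z).
pose b N := 2 * r ^+ N / (1 - r).
have q_props x : unit_circle R x -> [/\ x != 0, 1 - z / x != 0 & (1 - r)%:C%C <= `|1 - z / x|].
  move=> /= x1; have x0 : x != 0 by rewrite -normr_gt0 x1.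
  have q_ge : (1 - r)%:C%C <= `|1 - z / x|.
    have := lerB_dist 1 (z / x); rewrite normr1 normrM normfV x1 invr1 mulr1 zr.
    by rewrite (rmorphB (real_complex R)).
  split=> //; rewrite -normr_gt0; apply: lt_le_trans q_ge; by rewrite ltcR.
have F_partial N x : unit_circle R x -> `|F x - partial z N x| <= (b N)%:C%C.
  move=> x1; have [x0 q0 q_ge] := q_props x x1.
  have -> : F x - partial z N x = 2 * (z / x) ^+ N / (1 - z / x).
    rewrite /partial (eq_bigr (fun n : 'I_N => (z / x) ^+ n)); last first.
      by move=> n _; rewrite exprMn.
    have -> : \sum_(n < N) (z / x) ^+ n = (1 - (z / x) ^+ N) / (1 - z / x).
      by apply: (mulfI q0); rewrite geometric_sum mulrCA divff// mulr1.
    have -> : F x = (1 + z / x) / (1 - z / x).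
      have xz : x - z != 0.
        by have := mulf_neq0 x0 q0; rewrite mulrBr mulr1 mulrCA divff// mulr1.
      by rewrite /F; field; rewrite x0 xz.
    set q := z / x in q0 *; set qN := q ^+ N.
    by field.
  have x1' : `|x| = 1 by [].
  rewrite !normrM normfV normrX normrM normfV x1' invr1 mulr1 zr normr_nat.
  rewrite /b !(rmorphM (real_complex R)) (fmorphV (real_complex R)) rmorphXn /= rmorph_nat.
  apply: ler_pM => //; first by rewrite mulr_ge0// exprn_ge0// lecR.
  by rewrite lef_pV2 ?posrE ?normr_gt0 ?ltcR.
have b0 : b N @[N --> \oo] --> (0 : R).
  have rN : r ^+ N @[N --> \oo] --> (0 : R) by apply: cvg_expr; rewrite ger0_norm.
  rewrite [X in _ --> X](_ : 0 = 2 * 0 * (1 - r)^-1); last by rewrite mulr0 mul0r.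
  exact: (cvgM (cvgM (cvg_cst (2 : R)) rN) (cvg_cst (1 - r)^-1)).
have FI : circle_integrable F.
  (* The bound on [F] is the error estimate for N = 0, where the truncation is the constant -1. *)
  apply: (circle_integrable_limit (fun N => (partial_integrable z N).1) F_partial b0
    (c := b 0%N + 1)) => x x1.
  have := F_partial 0%N x x1; rewrite /partial big_ord0 mulr0 addr0 opprK => F0.
  rewrite -[F x](addrK 1) (rmorphD (real_complex R)).
  by apply: le_trans (ler_normB _ _) _; rewrite normr1; apply: lerD.
apply/cvgrPdist_lt => e e0; have /RRe_real eE := gtr0_real e0.
have c0 : 0 < complex.Re e / 2 by rewrite divr_gt0// -ltcR eE.
have /cvgrPdist_lt/(_ _ c0)[N0 _ bN0] := b0; exists N0 => // N /bN0.
rewrite /= sub0r normrN => /(le_lt_trans (ler_norm _)) bN.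
have -> : 2 * (\sum_(n < N) c n * z ^+ n) - 1 = circle_integral mu (partial z N).
  rewrite (partial_integrable z N).2 addrC; congr (_ + 2 * _).
  by apply: eq_bigr => n _; rewrite mulrC.
have [pI _] := partial_integrable z N.
have NI : circle_integrable (fun x => -1 * partial z N x).
  by apply: (@circle_integrableM _ (fun=> -1)) => //; exact: circle_integrable_cst.
have -> : herglotz mu z - circle_integral mu (partial z N) =
    circle_integral mu (fun x => F x + -1 * partial z N x).
  rewrite (circle_integralD mu_circle FI NI) (circle_integralZ mu_circle (-1) pI).
  by rewrite mulN1r.
apply: (@le_lt_trans _ _ (2 * b N)%:C%C).
  apply: norm_circle_integral => // [|x x1]; first exact: circle_integrableD.
  by rewrite mulN1r; exact: F_partial.
by rewrite -eE ltcR mulrC -ltr_pdivlMr.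
Qed.

End HerglotzSeries.

(** The two forms of the series, starting at n = 0 and at n = 1, have the same partial sums except
    at N = 0, where they are -1 and 1. *)
Lemma eq_cvg_from1 (R : realType) (u v : nat -> R[i]) (l : R[i]) :
  (forall N, u N.+1 = v N.+1) -> u N @[N --> \oo] --> l -> v N @[N --> \oo] --> l.
Proof.
move=> uv ul; apply/cvgrPdist_lt => e e0.
have /cvgrPdist_lt/(_ _ e0)[N0 _ uN0] := ul; exists N0.+1 => // -[//|N] /= N0N.
by rewrite -uv; apply: uN0; exact: leqW.
Qed.

Lemma cvg_unique_complex (R : realType) (u : nat -> R[i]) (x y : R[i]) :
  u N @[N --> \oo] --> x -> u N @[N --> \oo] --> y -> x = y.
Proof. exact: (@cvg_unique _ (@norm_hausdorff _ _)). Qed.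

Theorem proposition3 (R : realType) (A : algType R[i]) (star : A -> A)
    (tau : {scalar A}) (P : A) (theta : R) (Y : R -> A)
    (mu : R -> probability (borelC R) R)
    (S := 2 * P - 1 : A) (kappa := tau S : R[i])
    (U := fun t : R => S * Y t * S * star (Y t) : A)
    (H := fun (t : R) (z : R[i]) => herglotz (mu t) z) :
  is_wstar_probability_space star tau ->
  is_projection star P ->
  tau P = theta%:C%C -> 0 < theta <= 1 ->
  is_free_unitary_brownian_motion star tau Y ->
  star_free_from_process star tau P Y ->
  (forall t : R, 0 <= t -> is_spectral_distribution star tau (U t) (mu t)) ->
  forall z : R[i], `|z| < 1 ->
  [/\ forall t : R, 0 <= t ->
        1 + 2 * \sum_(1 <= n < N) tau (U t ^+ n) * z ^+ n
          @[N --> \oo] --> H t z,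
      forall t : R, 0 <= t -> exists dtH dzH2 : R[i],
        [/\ is_time_derivative (fun s : R => H s z) t dtH,
            is_derive z 1 (fun w : R[i] => H t w ^+ 2) dzH2 &
            dtH + z / 2 * dzH2
              = 2 * kappa ^+ 2 * (z * (1 + z) / (1 - z) ^+ 3)] &
      H 0 z = (1 + z) / (1 - z)].
Proof.
move=> prob projP _ _ brownian freePY spectral z z1.
have z0 : 1 - z != 0.
  by apply: contraTneq z1 => /eqP; rewrite subr_eq0 => /eqP <-; rewrite normr1 ltxx.
have tau1 := state1 prob.
have inv : is_involution star by have [] := wstar_vn prob.
pose f n t := tau (U t ^+ n).
have f0 t : 0 <= t -> f 0%N t = 1 by [].
have f1 n t : 0 <= t -> `|f n t| <= 1.
  move=> t0; apply: (norm_tau_unitary inv tau1 (state_ge0 prob)).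
  by apply: is_unitaryX => //; exact: (is_unitary_spectral prob projP brownian).
have kappa1 : `|kappa| <= 1.
  apply: (norm_tau_unitary inv tau1 (state_ge0 prob)).
  exact: (symmetry_unitary prob projP).
have f_step n := spectral_one_step prob projP brownian freePY n.
have H_series t w : 0 <= t -> `|w| < 1 ->
    2 * (\sum_(n < N) f n t * w ^+ n) - 1 @[N --> \oo] --> H t w.
  move=> t0 w1; have [mu1 moments] := spectral t t0.
  apply: (herglotz_series mu1 (c := fun n => f n t)) => // n.
  rewrite /f -(tau_unitary_power_star prob projP).
  (* [Negz n] stands for the exponent -(n+1), so exponent 0 is treated apart. *)
  case: n => [|n].
    by rewrite -[RHS](moments 0); apply: eq_circle_integral => x _.
  by rewrite -[RHS](moments (Negz n)); apply: eq_circle_integral => x _; rewrite exprVn.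
pose G t w := (H t w + 1) / 2.
have G_series t w : 0 <= t -> `|w| < 1 ->
    \sum_(n < N) f n t * w ^+ n @[N --> \oo] --> G t w.
  move=> t0 w1; rewrite /G mulrC.
  rewrite (_ : (fun N => _) = fun N => 2^-1 * (2 * (\sum_(n < N) f n t * w ^+ n) - 1 + 1)).
    exact: (ccvgZ (ccvgD (H_series t w t0 w1) (ccvg_cst (c := 1)))).
  by apply/funext => N; rewrite subrK mulKf.
have HG t w : H t w = 2 * G t w - 1 by rewrite /G; field.
split.
- move=> t t0; apply: (eq_cvg_from1 _ (H_series t z t0 z1)) => N.
  rewrite big_add1 /= big_mkord big_ord_recl f0// expr0 mulr1.
  rewrite (eq_bigr (fun n : 'I_N => tau (U t ^+ n.+1) * z ^+ n.+1)) => [|n _]; last first.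
    by rewrite lift0.
  by ring.
- move=> t t0; have [dG [zdG quotient]] := space_derivative f1 G_series t0 z1.
  have time := time_derivative f0 f1 kappa1 f_step G_series t0 z1 zdG.
  exists (2 * (z * dG + - 2 * (G t z * (z * dG)) + kappa ^+ 2 * (z * (1 + z) / (1 - z) ^+ 3))).
  exists (2 * dG * (2 * H t z)); split.
  + rewrite /is_time_derivative.
    rewrite (_ : (fun h => _) = fun h => 2 * ((G (t + h) z - G t z) / h%:C%C)).
      exact: (ccvgZ time).
    by apply/funext => h; rewrite !HG; ring.
  + have Hq : (H t (z + h) - H t z) / h @[h --> (0 : R[i])^'] --> 2 * dG.
      rewrite (_ : (fun h => _) = fun h => 2 * ((G t (z + h) - G t z) / h)).
        exact: (ccvgZ quotient).
      by apply/funext => h; rewrite !HG; ring.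
    exact: (is_derive_quotient (F := fun w => H t w ^+ 2) (cvg_quotient_sqr (F := H t) Hq)).
  + by rewrite HG; field.
apply: (cvg_unique_complex (H_series 0 z (lexx 0) z1)).
rewrite (_ : (fun N => _) = fun N => 2 * (\sum_(n < N) 'C(n + 0, 0)%:R * z ^+ n) - 1).
  rewrite (_ : (1 + z) / (1 - z) = 2 * (1 - z)^-1 ^+ 1 - 1); last by field.
  exact: (ccvgB (ccvgZ (cvg_binomial_series (k := 0) z1)) (ccvg_cst (c := 1))).
apply/funext => N; congr (2 * _ - 1); apply: eq_bigr => n _.
(* At time 0 all moments are 1, so the series is geometric. *)
have U0 : U 0 = 1.
  by rewrite /U (fubm0 brownian) (star1 inv) !mulr1; exact: symmetry_sqr projP.
by rewrite bin0 /f U0 expr1n tau1.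
Qed.
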